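(* Let $C(B,N)$ be the free associative conformal algebra over a field $\mathbf{k}$ of characteristic $0$ generated by a well-ordered set $B$ with a bounded locality $N$. Let $S$ be a set of monic elements of $C(B,N)$ with $ind(\bar s)=0$ for every $s\in S$. Then $S$ is a Gröbner-Shirshov basis in $C(B,N)$ if and only if the set $A=\{[u]\in Irr(S)\mid ind(u)=0\}$ is a $\mathbf{k}[D]$-basis of $C(B,N|S)=C(B,N)/Id(S)$ (i.e. the images of the elements of $A$ form a basis of $C(B,N)/Id(S)$ as a free module over the polynomial ring $\mathbf{k}[D]$, acting through the map $D$).
   Context: Conformal algebras. $\mathbf{k}$ is a field of characteristic $0$. A conformal algebra is a $\mathbf{k}$-space $C$ with bilinear products $a_{(n)}b$ ($n\in\mathbb{Z}_{\ge0}$) and a linear map $D$ such that: for all $a,b$ there is $N(a,b)\in\mathbb{Z}_{\ge 0}$ with $a_{(n)}b=0$ for $n\ge N(a,b)$; $D(a_{(n)}b)=Da_{(n)}b+a_{(n)}Db$; $Da_{(n)}b=-n\,a_{(n-1)}b$ for $n>0$ and $Da_{(0)}b=0$. It is associative if $(a_{(n)}b)_{(m)}c=\sum_{t\ge0}(-1)^t\binom nt a_{(n-t)}(b_{(m+t)}c)$. An ideal is a $D$-stable subspace closed under all products with arbitrary elements on either side; $Id(S)$ is the ideal generated by $S$. For $N\in\mathbb{Z}_{\ge0}$, $C(B,N)$ is the free associative conformal algebra generated by $B$ subject to $a_{(n)}b=0$ for $a,b\in B$, $n\ge N$: any map $\varepsilon$ from $B$ to an associative conformal algebra $C$ with $\varepsilon(a)_{(n)}\varepsilon(b)=0$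 for all $a,b\in B$, $n\ge N$ extends uniquely to a homomorphism $C(B,N)\to C$. Words. $T$ is the set of associative normal words $u=b_{1(n_1)}b_{2(n_2)}\cdots b_{k(n_k)}D^ib_{k+1}$ with $b_j\in B$, $0\le n_j<N$, $k,i\ge0$; $|u|=k+1$, $ind(u)=i$; $u$ is $D$-free if $ind(u)=0$. $[u]=b_{1(n_1)}(b_{2(n_2)}(\cdots(b_{k(n_k)}D^ib_{k+1})\cdots))\in C(B,N)$ is the corresponding (right-normed) normal word; square brackets always denote right-normed bracketing. It is known that $\{[u]:u\in T\}$ is a $\mathbf{k}$-basis of $C(B,N)$. An element of $C(B,N)$ is $D$-free if all normal words occurring in it are. $uD^l$ is $u$ with $D^ib_{k+1}$ replaced by $D^{i+l}b_{k+1}$. If $u$ is $D$-free and $0\le n<N$, $u_{(n)}v\in T$ is the concatenation; if $a$ is empty, $a_{(n)}v$ means $v$. Ordering. $B$ is well-ordered; for $u\in T$, $wt(u)=(|u|,b_1,n_1,\dots,b_k,n_k,b_{k+1},i)$, and $u>v$ iff $wt(u)>wt(v)$ lexicographically; this well-orders $T$, and $u>0$ for all $u\in T$. For $0\ne f\in C(B,N)$, $\bar f\in T$ is the largest word occurring in $f$; $\bar0=0$; $f$ is monic if $\bar f$ has coefficient $1$. Normal $S$-words. For a set $S$ of monic elements, a normal $S$-word $[u]_{D^is}$ is either (first kind) $[a_{(n)}s_{(m)}c]$ with $s\in S$, $a,c\in T$ ($a$ may be empty), $a$ and $\bar s$ $D$-free, $0\le n,m<N$; or (second kind) $[a_{(n)}D^is]$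 with $s\in S$, $i\ge0$, $a\in T$ $D$-free ($a$ may be empty), $0\le n<N$. Here, for $a=b_{1(n_1)}\cdots b_{k(n_k)}b_{k+1}$, $[a_{(n)}s_{(m)}c]=b_{1(n_1)}(\cdots(b_{k+1(n)}(s_{(m)}[c]))\cdots)$ and $[a_{(n)}D^is]=b_{1(n_1)}(\cdots(b_{k+1(n)}D^is)\cdots)$. $Irr(S)$ is the set of normal words $[u]$, $u\in T$, such that $u\ne\overline{[v]_{D^is}}$ for every normal $S$-word $[v]_{D^is}$. Compositions of monic $f,g$ (all product indices occurring in words lie in $[0,N)$): - inclusion: if $w=\bar f=a_{(n)}\bar g_{(m)}c$, $a,c\in T$, $a,\bar g$ $D$-free ($a$ may be empty), $(f,g)_w=f-[a_{(n)}g_{(m)}c]$; - right inclusion: if $w=\bar f=a_{(n)}\bar gD^i$, $a\in T$ $D$-free ($a$ may be empty), $i\ge0$, $(f,g)_w=f-[a_{(n)}D^ig]$; - intersection: if $w=\bar f_{(m)}c=a_{(n)}\bar g$, $a,c\in T$, $a,\bar f$ $D$-free, $|\bar f|+|\bar g|>|w|$, $(f,g)_w=[f_{(m)}c]-[a_{(n)}g]$; - right intersection: if $w=\bar fD^i=a_{(n)}\bar g$, $a\in T$ $D$-free, $i>0$, $(f,g)_w=D^if-[a_{(n)}g]$; - left multiplication: $b_{(n)}f$ with $b\in B$, $n\ge N$; - right multiplication: $f_{(n)}b$ with $b\in B$ and either ($\bar f$ not $D$-free and $0\le n<N$) or ($f$ not $D$-free and $n\ge N$). An element $h$ is trivial modulo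 $S$ if $h$ is a finite $\mathbf{k}$-linear combination of normal $S$-words $[u_i]_{D^{l_i}s_i}$ with $\overline{[u_i]_{D^{l_i}s_i}}\le\bar h$. $S$ is a Gröbner-Shirshov basis in $C(B,N)$ if all compositions of elements of $S$ are trivial modulo $S$. *)

(* Defs.v *)
From HB Require Import structures.
From mathcomp Require Import all_boot all_order all_algebra.
From mathcomp Require Import finmap boolp classical_sets.

Set Implicit Arguments.
Unset Strict Implicit.
Unset Printing Implicit Defensive.

Import Order.TTheory GRing.Theory.
Local Open Scope classical_set_scope.
Local Open Scope ring_scope.

(** * Conformal algebras *)

(* [nprod n a b] is a_(n) b and [cder] is D. *)
HB.mixin Record Lmodule_isConformal (k : fieldType) C & GRing.Lmodule k C := {
  nprod : nat -> C -> C -> C;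
  cder : C -> C;
  nprod_linear_l : forall n b, linear (nprod n ^~ b);
  nprod_linear_r : forall n a, linear (nprod n a);
  cder_linear : linear cder;
  nprod_local : forall a b, exists N, forall n, (N <= n)%N -> nprod n a b = 0;
  cder_nprod : forall n a b,
    cder (nprod n a b) = nprod n (cder a) b + nprod n a (cder b);
  nprod0_cder : forall a b, nprod 0%N (cder a) b = 0;
  nprodS_cder : forall n a b, nprod n.+1 (cder a) b = - (nprod n a b *+ n.+1)
}.

#[short(type="confAlgType")]
HB.structure Definition ConfAlg (k : fieldType) :=
  {C of GRing.Lmodule k C & Lmodule_isConformal k C}.

(* The sum over t >= 0 stops at t = n, as 'C(n, t) = 0 for t > n. *)
HB.mixin Record ConfAlg_isAssoc (k : fieldType) C & ConfAlg k C := {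
  nprodA : forall n m (a b c : C),
    nprod m (nprod n a b) c =
    \sum_(t < n.+1)
       ((-1) ^+ t * 'C(n, t)%:R : k) *: nprod (n - t)%N a (nprod (m + t)%N b c)
}.

#[short(type="assocConfAlgType")]
HB.structure Definition AssocConfAlg (k : fieldType) :=
  {C of ConfAlg k C & ConfAlg_isAssoc k C}.

Definition conf_hom (k : fieldType) (C C' : confAlgType k) (phi : C -> C') :=
  [/\ linear phi,
      forall a, phi (cder a) = cder (phi a)
    & forall n a b, phi (nprod n a b) = nprod n (phi a) (phi b)].

Section BilinearTheory.
Context {k : fieldType} {C : confAlgType k}.

HB.instance Definition _ := GRing.isLinear.Build k C C *:%R cder
  (@cder_linear k C).
HB.instance Definition _ n (a : C) :=
  GRing.isLinear.Build k C C *:%R (nprod n a) (nprod_linear_r n a).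

Lemma nprodDl n (a a' b : C) : nprod n (a + a') b = nprod n a b + nprod n a' b.
Proof. by have := nprod_linear_l n b 1 a a'; rewrite !scale1r. Qed.

Lemma nprod0l n (b : C) : nprod n 0 b = 0.
Proof. by apply: (addrI (nprod n 0 b)); rewrite -nprodDl !addr0. Qed.

Lemma nprodZl n x (a b : C) : nprod n (x *: a) b = x *: nprod n a b.
Proof.
by have := nprod_linear_l n b x a 0; rewrite nprod0l !addr0.
Qed.

Lemma nprodNl n (a b : C) : nprod n (- a) b = - nprod n a b.
Proof. by rewrite -scaleN1r nprodZl scaleN1r. Qed.

Lemma nprodBl n (a a' b : C) : nprod n (a - a') b = nprod n a b - nprod n a' b.
Proof. by rewrite nprodDl nprodNl. Qed.

End BilinearTheory.

(** * Ideals and quotients *)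

Definition is_conf_ideal (k : fieldType) (C : confAlgType k) (I : set C) :=
  [/\ I 0,
      forall (x : k) a b, I a -> I b -> I (x *: a + b),
      forall a, I a -> I (cder a),
      forall n a b, I b -> I (nprod n a b)
    & forall n a b, I a -> I (nprod n a b)].

Record conf_ideal (k : fieldType) (C : confAlgType k) := ConfIdeal {
  ideal_set : set C;
  ideal_setP : is_conf_ideal ideal_set
}.

Lemma Id_subproof (k : fieldType) (C : confAlgType k) (S : set C) :
  is_conf_ideal (smallest (@is_conf_ideal k C) S).
Proof.
split.
- by move=> I [[]].
- by move=> x a b Ia Ib I SI; have [[_ h _ _ _] _] := SI; apply: h; [exact: Ia | exact: Ib].
- by move=> a Ia I SI; have [[_ _ h _ _] _] := SI; apply: h; exact: Ia.
- by move=> n a b Ib I SI; have [[_ _ _ h _] _] := SI; apply: h; exact: Ib.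
- by move=> n a b Ia I SI; have [[_ _ _ _ h] _] := SI; apply: h; exact: Ia.
Qed.

Definition Id (k : fieldType) (C : confAlgType k) (S : set C) : conf_ideal C :=
  ConfIdeal (Id_subproof S).

Section Quotient.
Context {k : fieldType} {C : confAlgType k} (J : conf_ideal C).

Local Notation I := (ideal_set J).

Definition ideal_pred : {pred C} := fun x => `[< I x >].

Lemma ideal_predP x : reflect (I x) (x \in ideal_pred).
Proof. exact: asboolP. Qed.

Lemma ideal_pred_zmod : zmod_closed ideal_pred.
Proof.
have [I0 Il _ _ _] := ideal_setP J.
split=> [|x y /ideal_predP Ix /ideal_predP Iy]; apply/ideal_predP => //.
by rewrite addrC -scaleN1r; apply: Il.
Qed.

HB.instance Definition _ :=
  GRing.isZmodClosed.Build C ideal_pred ideal_pred_zmod.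

Definition conf_quot := Quotient.quot ideal_pred.

HB.instance Definition _ := GRing.Zmodule.on conf_quot.

Definition qproj (x : C) : conf_quot := \pi_(Quotient.quot ideal_pred)%qT x.
Definition qrepr (x : conf_quot) : C := repr x.

Lemma qreprK x : qproj (qrepr x) = x.
Proof. exact: reprK. Qed.

Lemma qproj_eq x y : qproj x = qproj y <-> I (x - y).
Proof.
rewrite /qproj; split=> [/eqP|h]; last apply/eqP.
  by rewrite -Quotient.idealrBE => /ideal_predP.
by rewrite -Quotient.idealrBE; apply/ideal_predP.
Qed.

Lemma qproj_repr x : I (qrepr (qproj x) - x).
Proof. by apply/qproj_eq; rewrite qreprK. Qed.

Lemma qprojD x y : qproj (x + y) = qproj x + qproj y.
Proof. exact: Quotient.pi_add. Qed.

Definition qscale (x : k) (a : conf_quot) := qproj (x *: qrepr a).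
Definition qnprod n (a b : conf_quot) := qproj (nprod n (qrepr a) (qrepr b)).
Definition qcder (a : conf_quot) := qproj (cder (qrepr a)).

Lemma ideal_scale x a : I a -> I (x *: a).
Proof.
by move=> Ia; have [I0 Il _ _ _] := ideal_setP J; rewrite -[_ *: _]addr0; apply: Il.
Qed.

Lemma idealD a b : I a -> I b -> I (a + b).
Proof.
move=> Ia Ib; have [I0 Il _ _ _] := ideal_setP J.
by rewrite -[a]scale1r; apply: Il.
Qed.

Lemma qproj_scale x a : qproj (x *: a) = qscale x (qproj a).
Proof.
apply/esym/qproj_eq; rewrite -scalerBr; apply: ideal_scale; exact: qproj_repr.
Qed.

Lemma qproj_cder a : qproj (cder a) = qcder (qproj a).
Proof.
apply/esym/qproj_eq; rewrite -linearB /=.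
by have [_ _ h _ _] := ideal_setP J; apply: h; apply: qproj_repr.
Qed.

Lemma qproj_nprod n a b : qproj (nprod n a b) = qnprod n (qproj a) (qproj b).
Proof.
apply/esym/qproj_eq; have [_ _ _ hl hr] := ideal_setP J.
set a' := qrepr _; set b' := qrepr _.
have -> : nprod n a' b' - nprod n a b = nprod n (a' - a) b' + nprod n a (b' - b).
  by rewrite nprodBl linearB /= addrA subrK.
by apply: idealD; [apply: hr | apply: hl]; apply: qproj_repr.
Qed.

Lemma qscaleA x y a : qscale x (qscale y a) = qscale (x * y) a.
Proof. by rewrite -[a]qreprK -!qproj_scale scalerA. Qed.
Lemma qscale1 : left_id 1 qscale.
Proof. by move=> a; rewrite -[a]qreprK -!qproj_scale scale1r. Qed.
Lemma qscaleDr : right_distributive qscale +%R.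
Proof.
move=> x a b; rewrite -[a]qreprK -[b]qreprK -qprojD -!qproj_scale scalerDr.
by rewrite qprojD.
Qed.
Lemma qscaleDl a : {morph qscale^~ a : x y / x + y}.
Proof. by move=> x y; rewrite -[a]qreprK -!qproj_scale scalerDl qprojD. Qed.

HB.instance Definition _ := GRing.Zmodule_isLmodule.Build k conf_quot
  qscaleA qscale1 qscaleDr qscaleDl.

Lemma qproj_linear : linear qproj.
Proof. by move=> x a b; rewrite qprojD qproj_scale. Qed.

HB.instance Definition _ :=
  GRing.isLinear.Build k C conf_quot *:%R qproj qproj_linear.

Lemma qnprod_linear_l n b : linear (qnprod n ^~ b).
Proof.
move=> x a a' /=; rewrite -[a]qreprK -[a']qreprK -[b]qreprK -qproj_linear.
by rewrite -!qproj_nprod -qproj_linear nprod_linear_l.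
Qed.
Lemma qnprod_linear_r n a : linear (qnprod n a).
Proof.
move=> x b b'; rewrite -[a]qreprK -[b]qreprK -[b']qreprK -qproj_linear.
by rewrite -!qproj_nprod -qproj_linear nprod_linear_r.
Qed.
Lemma qcder_linear : linear qcder.
Proof.
move=> x b b'; rewrite -[b]qreprK -[b']qreprK -qproj_linear.
by rewrite -!qproj_cder -qproj_linear cder_linear.
Qed.
Lemma qnprod_local a b : exists N, forall n, (N <= n)%N -> qnprod n a b = 0.
Proof.
have [N hN] := nprod_local (qrepr a) (qrepr b); exists N => n /hN h.
by rewrite /qnprod h linear0.
Qed.
Lemma qcder_nprod n a b :
  qcder (qnprod n a b) = qnprod n (qcder a) b + qnprod n a (qcder b).
Proof.
rewrite -[a]qreprK -[b]qreprK -qproj_nprod -!qproj_cder -!qproj_nprod.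
by rewrite -linearD cder_nprod.
Qed.
Lemma qnprod0_cder a b : qnprod 0%N (qcder a) b = 0.
Proof.
by rewrite -[a]qreprK -[b]qreprK -qproj_cder -qproj_nprod nprod0_cder linear0.
Qed.
Lemma qnprodS_cder n a b : qnprod n.+1 (qcder a) b = - (qnprod n a b *+ n.+1).
Proof.
rewrite -[a]qreprK -[b]qreprK -qproj_cder -!qproj_nprod nprodS_cder.
by rewrite linearN linearMn.
Qed.

HB.instance Definition _ := Lmodule_isConformal.Build k conf_quot
  qnprod_linear_l qnprod_linear_r qcder_linear qnprod_local
  qcder_nprod qnprod0_cder qnprodS_cder.

Lemma qproj_hom : conf_hom qproj.
Proof.
by split; [exact: qproj_linear | exact: qproj_cder | exact: qproj_nprod].
Qed.

End Quotient.

Section AssocQuotient.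
Context {k : fieldType} {C : assocConfAlgType k} (J : conf_ideal C).

Lemma qnprodA n m (a b c : conf_quot J) :
  nprod m (nprod n a b) c =
  \sum_(t < n.+1)
     ((-1) ^+ t * 'C(n, t)%:R : k) *: nprod (n - t)%N a (nprod (m + t)%N b c).
Proof.
have [_ _ homM] := qproj_hom J.
rewrite -[a]qreprK -[b]qreprK -[c]qreprK -homM -homM nprodA linear_sum.
by apply: eq_bigr => t _; rewrite linearZ /= !homM.
Qed.

HB.instance Definition _ := ConfAlg_isAssoc.Build k (conf_quot J) qnprodA.

End AssocQuotient.

(** * The k[D]-module underlying a conformal algebra *)

(* A copy of C carrying the {poly k}-module structure in which 'X acts as D. *)
Definition kD_module (k : fieldType) (C : confAlgType k) : Type := C.

Section KDModule.
Context {k : fieldType} {C : confAlgType k}.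

HB.instance Definition _ := GRing.Zmodule.copy (kD_module C) C.

Definition kD_scale (p : {poly k}) (x : kD_module C) : kD_module C :=
  \sum_(i < size p) p`_i *: (iter i cder x : C).

Lemma iter_cder_linear i : linear (iter i (@cder k C)).
Proof. by elim: i => [|i IH] x a b //=; rewrite IH linearP. Qed.

HB.instance Definition _ i := GRing.isLinear.Build k C C *:%R
  (iter i (@cder k C)) (iter_cder_linear i).

Lemma kD_scale_widen n (p : {poly k}) (x : C) : (size p <= n)%N ->
  kD_scale p x = \sum_(i < n) p`_i *: (iter i cder x : C).
Proof.
move=> le_p_n; rewrite /kD_scale (big_ord_widen _ (fun i => p`_i *: iter i cder x) le_p_n).
rewrite big_mkcond; apply: eq_bigr => i _; case: ltnP => // ?.
by rewrite nth_default ?scale0r.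
Qed.

Lemma kD_scale_linear (p : {poly k}) : linear (kD_scale p : C -> C).
Proof.
move=> x a b; rewrite /kD_scale scaler_sumr -big_split /=; apply: eq_bigr => i _.
by rewrite linearP scalerDr scalerA mulrC -scalerA.
Qed.

Lemma kD_scalePl (x : k) p q (a : C) :
  kD_scale (x *: p + q) a = x *: (kD_scale p a : C) + kD_scale q a.
Proof.
pose n := maxn (size (x *: p + q)) (maxn (size p) (size q)).
rewrite !(@kD_scale_widen n) ?leq_max ?leqnn ?orbT //.
rewrite scaler_sumr -big_split; apply: eq_bigr => i _ /=.
by rewrite coefD coefZ scalerDl scalerA.
Qed.

Lemma kD_scaleXM p (a : C) : kD_scale ('X * p) a = cder (kD_scale p a : C).
Proof.
rewrite (@kD_scale_widen (size p).+1); last first.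
  by rewrite mulrC; have [->|p0] := eqVneq p 0; rewrite ?mul0r ?size_poly0 ?size_mulX.
rewrite big_ord_recl coefXM scale0r add0r /kD_scale linear_sum.
by apply: eq_bigr => i _; rewrite coefXM linearZ.
Qed.

Lemma kD_scale0 (a : C) : kD_scale 0 a = 0.
Proof. by rewrite /kD_scale size_poly0 big_ord0. Qed.

Lemma kD_scale1 : left_id 1 kD_scale.
Proof.
by move=> a; rewrite /kD_scale size_poly1 big_ord1 coef1 (@scale1r k C).
Qed.

Lemma kD_scaleA p q a : kD_scale p (kD_scale q a) = kD_scale (p * q) a.
Proof.
elim/poly_ind: p => [|p x IH]; first by rewrite mul0r !kD_scale0.
have -> : p * 'X + x%:P = x *: 1 + 'X * p by rewrite alg_polyC addrC ['X * p]mulrC.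
by rewrite mulrDl -scalerAl mul1r -mulrA !kD_scalePl kD_scale1 !kD_scaleXM IH.
Qed.

Lemma kD_scaleDr : right_distributive kD_scale +%R.
Proof. by move=> p a b; have := kD_scale_linear p 1 a b; rewrite !(@scale1r k C). Qed.

Lemma kD_scaleDl a : {morph kD_scale^~ a : p q / p + q}.
Proof. by move=> p q; have := kD_scalePl 1 p q a; rewrite scale1r (@scale1r k C). Qed.

HB.instance Definition _ := GRing.Zmodule_isLmodule.Build {poly k} (kD_module C)
  kD_scaleA kD_scale1 kD_scaleDr kD_scaleDl.

End KDModule.

(** * Finite linear combinations and bases *)

Definition lincomb (R : pzRingType) (M : lmodType R) (J : choiceType)
    (v : J -> M) (c : {fsfun J -> R with 0}) : M :=
  \sum_(j <- finsupp c) c j *: v j.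

(* The family (v j), j in A, is a basis of M. *)
Definition is_basis (R : pzRingType) (M : lmodType R) (J : choiceType)
    (A : set J) (v : J -> M) : Prop :=
  (forall x : M, exists c : {fsfun J -> R with 0},
     (forall j, j \in finsupp c -> A j) /\ x = lincomb v c) /\
  (forall c : {fsfun J -> R with 0},
     (forall j, j \in finsupp c -> A j) -> lincomb v c = 0 ->
     forall j, c j = 0).

(** * Words *)

Section Words.
Context {disp : Order.disp_t} {B : orderType disp} {N : nat}.

(* [:: (b_1, n_1); ...; (b_k, n_k)] stands for the left multiplier
   b_1 (n_1) ( ... b_k (n_k) _ ): it encodes "a_(n)" for a D-free word a,
   possibly empty, and an index 0 <= n < N (the pair (last letter of a, n)
   comes last in the list). *)
Definition multiplier : Type := seq (B * 'I_N).

(* ((b_1, n_1) ... (b_k, n_k), (b_(k+1), i)) is the word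
   b_1 (n_1) ... b_k (n_k) D^i b_(k+1). *)
Definition word : Type := multiplier * (B * nat).

HB.instance Definition _ := Choice.on word.

Definition ind (u : word) : nat := u.2.2.
Definition wlen (u : word) : nat := (size u.1).+1.

Definition wD (u : word) (l : nat) : word := (u.1, (u.2.1, u.2.2 + l)%N).

(* a_(n) v, with p standing for a_(n) *)
Definition wmul (p : multiplier) (v : word) : word := (p ++ v.1, v.2).

(* u_(m) as a multiplier; meant for D-free u *)
Definition wmult (u : word) (m : 'I_N) : multiplier := rcons u.1 (u.2.1, m).

(* Words of equal length have lists of pairs of equal length, for which this
   is the lexicographic order on (|u|, b_1, n_1, ..., b_k, n_k, b_(k+1), i). *)
Definition wt (u : word) : nat *l (seqlexi (B *l 'I_N) *l (B *l nat)) :=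
  (wlen u, (u.1, u.2)).

Definition wle (u v : word) : bool := (wt u <= wt v)%O.

(* T with 0 (that is, None) added as least element *)
Definition owle (o o' : option word) : bool :=
  match o, o' with
  | None, _ => true
  | Some _, None => false
  | Some u, Some v => wle u v
  end.

End Words.

Arguments multiplier {disp} B N.
Arguments word {disp} B N.

(** * The free associative conformal algebra with locality N *)

Definition free_assoc_conf (k : fieldType) (B : Type) (N : nat)
    (C : assocConfAlgType k) (iota : B -> C) : Prop :=
  (forall a b n, (N <= n)%N -> nprod n (iota a) (iota b) = 0) /\
  forall (C' : assocConfAlgType k) (eps : B -> C'),
    (forall a b n, (N <= n)%N -> nprod n (eps a) (eps b) = 0) ->
    exists phi : C -> C',
      [/\ conf_hom phi, phi \o iota =1 eps
        & forall psi : C -> C', conf_hom psi -> psi \o iota =1 eps -> psi =1 phi].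

Section GroebnerShirshov.
Context {k : fieldType} {disp : Order.disp_t} {B : orderType disp} {N : nat}.
Context {C : assocConfAlgType k} (iota : B -> C).

Local Notation T := (word B N).

Definition pmul (p : multiplier B N) (x : C) : C :=
  foldr (fun (bn : B * 'I_N) y => nprod bn.2 (iota bn.1) y) x p.

(* The normal word [u] *)
Definition nw (u : T) : C := pmul u.1 (iter u.2.2 cder (iota u.2.1)).

(* The coordinates of f in the normal words, when C is free: [nw] is then a
   basis of C, so that exactly one c satisfies f = lincomb nw c. *)
Definition coefs (f : C) : {fsfun T -> k with 0} :=
  xget [fsfun] [set c | f = lincomb nw c].

Definition occurs (u : T) (f : C) : Prop := coefs f u != 0.

Definition D_free (f : C) : Prop := forall u, occurs u f -> ind u = 0%N.

Definition leading (f : C) (w : T) : Prop :=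
  occurs w f /\ forall u, occurs u f -> wle u w.

(* None stands for the value 0 of bar 0. *)
Definition bar (f : C) : option T := xget None (Some @` leading f).

Definition nw_monic (f : C) : Prop := exists w, bar f = Some w /\ coefs f w = 1.

Inductive normal_Sword (S : set C) : C -> Prop :=
| Sword_first (p : multiplier B N) (s : C) (w : T) (m : 'I_N) (c : T) of
    S s & bar s = Some w & ind w = 0%N :
    normal_Sword S (pmul p (nprod m s (nw c)))
| Sword_second (p : multiplier B N) (i : nat) (s : C) of S s :
    normal_Sword S (pmul p (iter i cder s)).

Definition Irr (S : set C) : set C :=
  [set nw u | u in [set u : T | forall x, normal_Sword S x -> bar x <> Some u]].

(* [composition f g h]: h is a composition of f and g; compositions of left
   and right multiplication involve f only.
   The condition p <> [::] says that the word a in a_(n) is not empty. *)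
Inductive composition (f g : C) : C -> Prop :=
| comp_inclusion (p : multiplier B N) (m : 'I_N) (c w v : T) of
    bar f = Some w & bar g = Some v & ind v = 0%N &
    w = wmul p (wmul (wmult v m) c) :
    composition f g (f - pmul p (nprod m g (nw c)))
| comp_right_inclusion (p : multiplier B N) (i : nat) (w v : T) of
    bar f = Some w & bar g = Some v &
    w = wmul p (wD v i) :
    composition f g (f - pmul p (iter i cder g))
| comp_intersection (p : multiplier B N) (m : 'I_N) (c u v w : T) of
    bar f = Some u & bar g = Some v & ind u = 0%N & p <> [::] &
    w = wmul (wmult u m) c & w = wmul p v &
    (wlen w < wlen u + wlen v)%N :
    composition f g (nprod m f (nw c) - pmul p g)
| comp_right_intersection (p : multiplier B N) (i : nat) (u v w : T) of
    bar f = Some u & bar g = Some v & p <> [::] & (0 < i)%N &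
    w = wD u i & w = wmul p v :
    composition f g (iter i cder f - pmul p g)
| comp_left_mult (b : B) (n : nat) of (N <= n)%N :
    composition f g (nprod n (iota b) f)
| comp_right_mult (b : B) (n : nat) of
    ((exists2 w, bar f = Some w & ind w <> 0%N) /\ (n < N)%N) \/
    (~ D_free f /\ (N <= n)%N) :
    composition f g (nprod n f (iota b)).

Definition trivial_mod (S : set C) (h : C) : Prop :=
  exists c : {fsfun C -> k with 0},
    (forall x, x \in finsupp c -> normal_Sword S x /\ owle (bar x) (bar h)) /\
    h = lincomb id c.

Definition GS_basis (S : set C) : Prop :=
  forall f g h, S f -> S g -> composition f g h -> trivial_mod S h.

Definition D_free_Irr (S : set C) : set C :=
  [set nw u | u in [set u : T | Irr S (nw u) /\ ind u = 0%N]].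

End GroebnerShirshov.

Arguments nw_monic {k disp B} N {C} iota f.
Arguments GS_basis {k disp B} N {C} iota S.
Arguments D_free_Irr {k disp B} N {C} iota S.

(* Main.v *)
(* The free algebra is a free left module over the free associative algebra on
   the operators b_(n), n < N, with basis the D^i b.  A normal S-word is thus a
   left multiple of r(s), where s is in S and r is a right operator, x |-> D^i x
   or x |-> x_(m) [c].  As the leading words of S are D-free, two normal S-words
   with the same leading word differ, up to a common left multiplier, by a
   disjoint overlap or by a composition followed by a right operator.  So if S is
   a Groebner-Shirshov basis, they agree modulo smaller normal S-words; moreover
   Id(S) is the span of the normal S-words, and the leading words of its nonzero
   elements are reducible.  For D-free u the word u D^i is reducible if and only
   if u is; hence division by normal S-words shows that A generates the quotient
   over k[D], and comparison of leading words shows that A is independent.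
   Conversely, dividing a composition by normal S-words leaves a remainder in the
   k[D]-span of A that belongs to Id(S), so this remainder is zero.

   The normal words are independent because they are so in the associative
   conformal algebra k[D] (x) F, where F is the free associative algebra on the
   letters d^j b with j < N (and d^N b = 0) and a_(n) y = a (d + d/dD)^n y for a
   in F: there b1_(n1) ... bk_(nk) D^i b has leading monomial
   D^i b1 (d^n1 b2) ... (d^nk b). *)
Require Import Defs.
From HB Require Import structures.
From mathcomp Require Import all_boot all_order all_algebra.
From mathcomp Require Import finmap boolp classical_sets.
From mathcomp.multinomials Require Import monalg.
From mathcomp Require Import ring zify.

Set Implicit Arguments.
Unset Strict Implicit.
Unset Printing Implicit Defensive.

Import Order.TTheory GRing.Theory.
Local Open Scope ring_scope.

(** * Linear spans *)

(** The algebra is known only through its universal property. Normal words span it because the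
    elements in their span form a subalgebra containing [B]; independence needs a map out, hence an
    explicit model. There [d + d/dD, D] = 1 is the rule b_(n) Dy = D (b_(n) y) + n b_(n-1) y, and
    d^N b = 0 gives locality. The obstacle in the ideal part is products with an index n >= N: they
    are not words, and associativity rewrites them into combinations whose leading words are not
    tracked. What survives is a bound on the length, and this suffices, because such products occur
    only behind a letter or an index already smaller than in the word of comparison. Hence estimates
    are of two kinds: by length ([len_le]) or strictly below a word ([below]). D-freeness enters
    because right multiplication does not respect the order in general: b < Db, yet (Db)_(m) c = - m
    b_(m-1) c has a smaller leading word than b_(m) c. The order survives when the larger word is
    D-free. *)

Section Span.
Context {R : pzRingType}.
Implicit Types V W : lmodType R.

(** The inductive form lets proofs treat a combination one generator at a time. It is used over [k]
    and also over [{poly k}]. *)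
Inductive lspan V (X : V -> Prop) : V -> Prop :=
| lspan0 : lspan X 0
| lspanZD c x y of X x & lspan X y : lspan X (c *: x + y).

Lemma lspan_gen V (X : V -> Prop) x : X x -> lspan X x.
Proof. by move=> Xx; have := lspanZD 1 Xx (lspan0 X); rewrite scale1r addr0. Qed.

Lemma lspanD V (X : V -> Prop) x y : lspan X x -> lspan X y -> lspan X (x + y).
Proof.
move=> + Xy; elim=> [|c z t Xz _ IH]; first by rewrite add0r.
by rewrite -addrA; apply: lspanZD.
Qed.

Lemma lspan_image V W (f : V -> W) (X : V -> Prop) (Y : W -> Prop) x :
  linear f -> (forall x, X x -> lspan Y (f x)) -> lspan X x -> lspan Y (f x).
Proof.
move=> fl XY; have f0 : f 0 = 0.
  by have := fl (-1) 0 0; rewrite scaler0 addr0 scaleN1r addNr.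
elim=> [|c z t Xz _ IH]; first by rewrite f0; apply: lspan0.
rewrite fl; elim: {z Xz}(f z) / (XY _ Xz) => [|d u v Yu _ IH'].
  by rewrite scaler0 add0r.
by rewrite scalerDr scalerA -addrA; apply: lspanZD.
Qed.

Lemma lspan_trans V (X Y : V -> Prop) x :
  (forall x, X x -> lspan Y x) -> lspan X x -> lspan Y x.
Proof. by apply: (@lspan_image _ _ id). Qed.

Lemma lspan_mono V (X Y : V -> Prop) x :
  (forall x, X x -> Y x) -> lspan X x -> lspan Y x.
Proof. by move=> XY; apply: lspan_trans => y /XY; apply: lspan_gen. Qed.

Lemma lspanZ V (X : V -> Prop) (c : R) x : lspan X x -> lspan X (c *: x).
Proof.
elim=> [|d z t Xz _ IH]; first by rewrite scaler0; apply: lspan0.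
by rewrite scalerDr scalerA; apply: lspanZD.
Qed.

Lemma lspanN V (X : V -> Prop) x : lspan X x -> lspan X (- x).
Proof. by rewrite -scaleN1r; apply: lspanZ. Qed.

Lemma lspanB V (X : V -> Prop) x y : lspan X x -> lspan X y -> lspan X (x - y).
Proof. by move=> Xx Xy; apply: lspanD => //; apply: lspanN. Qed.

Lemma lspanMn V (X : V -> Prop) x n : lspan X x -> lspan X (x *+ n).
Proof. by rewrite -scaler_nat; apply: lspanZ. Qed.

Lemma lspan_sum V (X : V -> Prop) (I : Type) (r : seq I) (P : pred I) (F : I -> V) :
  (forall i, P i -> lspan X (F i)) -> lspan X (\sum_(i <- r | P i) F i).
Proof. by move=> XF; elim/big_ind: _ => //; [apply: lspan0 | apply: lspanD]. Qed.

Lemma lincombEw V (J : choiceType) (v : J -> V) (c : {fsfun J -> R with 0})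
  (F : {fset J}) : (finsupp c `<=` F)%fset ->
  lincomb v c = \sum_(j <- F) c j *: v j.
Proof.
move=> cF; rewrite /lincomb; apply: big_fset_incl => // j _ /fsfun_dflt ->.
by rewrite scale0r.
Qed.

Lemma lincomb_linear V (J : choiceType) (v : J -> V) (a : R)
  (c d : {fsfun J -> R with 0}) :
  exists2 f : {fsfun J -> R with 0}, (forall j, f j = a * c j + d j) &
    lincomb v f = a *: lincomb v c + lincomb v d.
Proof.
pose F := (finsupp c `|` finsupp d)%fset.
pose f : {fsfun J -> R with 0} := [fsfun j in F => a * c j + d j].
have fE j : f j = a * c j + d j.
  rewrite fsfunE; case: ifPn => //; rewrite in_fsetU negb_or => /andP[cj dj].
  by rewrite !fsfun_dflt // mulr0 addr0.
exists f => //; rewrite (@lincombEw _ _ v f F).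
  rewrite (@lincombEw _ _ v c F) ?fsubsetUl // (@lincombEw _ _ v d F) ?fsubsetUr //.
  rewrite scaler_sumr -big_split /=; apply: eq_bigr => j _.
  by rewrite fE scalerDl scalerA.
apply/fsubsetP=> j; rewrite mem_finsupp fsfunE.
by case: (j \in F) => //; rewrite eqxx.
Qed.

Lemma lincomb1 V (J : choiceType) (v : J -> V) j :
  exists2 f : {fsfun J -> R with 0}, (forall i, f i = (i == j)%:R) &
    lincomb v f = v j.
Proof.
pose f : {fsfun J -> R with 0} := [fsfun i in [fset j]%fset => 1].
have fE i : f i = (i == j)%:R by rewrite fsfunE in_fset1; case: eqP.
exists f => //; rewrite (@lincombEw _ _ v f [fset j]%fset).
  by rewrite big_seq_fset1 fE eqxx scale1r.
apply/fsubsetP=> i; rewrite mem_finsupp fE in_fset1.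
by case: (i == j) => //; rewrite eqxx.
Qed.

Lemma lspan_lincombP V (J : choiceType) (v : J -> V) (A : J -> Prop) x :
  lspan (fun y => exists2 j, A j & y = v j) x <->
  exists c : {fsfun J -> R with 0},
    (forall j, j \in finsupp c -> A j) /\ x = lincomb v c.
Proof.
split=> [|[c [cA ->]]].
  elim=> [|a _ y [j0 Aj0 ->] _ [c [cA ->]]].
    by exists [fsfun]; split=> [j|]; rewrite ?finsupp0 // /lincomb finsupp0 big_nil.
  pose F := (j0 |` finsupp c)%fset.
  (* The index [j0] may already lie in the support of [c], so [a] is added to its coefficient. *)
  pose d : {fsfun J -> R with 0} := [fsfun j in F => c j + (if j == j0 then a else 0)].
  have dF : (finsupp d `<=` F)%fset.
    apply/fsubsetP=> j; rewrite mem_finsupp fsfunE.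
    by case: (j \in F) => //; rewrite eqxx.
  exists d; split=> [j /(fsubsetP dF)|].
    by rewrite in_fset1U => /orP[/eqP-> // | /cA].
  rewrite (lincombEw _ dF) (@lincombEw _ _ _ c F) ?fsubsetU1 //.
  have j0F : j0 \in F by rewrite in_fset1U eqxx.
  have -> : a *: v j0 = \sum_(j <- F) (if j == j0 then a else 0) *: v j.
    rewrite (big_fsetD1 j0) //= eqxx big1_seq ?addr0 // => j.
    by rewrite in_fsetD1 /= => /andP[/negPf-> _]; rewrite scale0r.
  rewrite -big_split /= big_seq [RHS]big_seq; apply: eq_bigr => j jF.
  by rewrite /d fsfunE jF scalerDl addrC.
rewrite /lincomb big_seq; apply: lspan_sum => j jc; apply: lspanZ.
by apply: lspan_gen; exists j => //; apply: cA.
Qed.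

End Span.

(** * The order on words *)

Section WordOrder.
Context {disp : Order.disp_t} {B : orderType disp} {N : nat}.
Local Notation T := (word B N).
Implicit Types (u v w : T) (p q : multiplier B N) (x y : B * 'I_N).

Definition wlt u v : bool := (wt u < wt v)%O.

Lemma wt_inj : injective (@wt disp B N).
Proof. by case=> [p l] [q r] []; rewrite /wlen /= => _ -> ->. Qed.

Lemma wle_refl u : wle u u. Proof. exact: lexx. Qed.
Lemma wlt_trans v u w : wlt u v -> wlt v w -> wlt u w. Proof. exact: lt_trans. Qed.
Lemma wle_trans v u w : wle u v -> wle v w -> wle u w. Proof. exact: le_trans. Qed.
Lemma wle_lt_trans v u w : wle u v -> wlt v w -> wlt u w.
Proof. exact: le_lt_trans. Qed.
Lemma wlt_irr u : wlt u u = false. Proof. exact: ltxx. Qed.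
Lemma wltNge u v : wlt u v = ~~ wle v u. Proof. by rewrite /wlt /wle ltNge. Qed.
Lemma wleNgt u v : wle u v = ~~ wlt v u. Proof. by rewrite /wlt /wle leNgt. Qed.
Lemma wle_eqVlt u v : wle u v = (u == v) || wlt u v.
Proof. by rewrite /wle le_eqVlt (inj_eq wt_inj). Qed.

Lemma wlt_cons x y p q l r : size p = size q ->
  wlt (x :: p, l) (y :: q, r) =
  ((x : B *l 'I_N) < y)%O || (x == y) && wlt (p, l) (q, r).
Proof.
move=> pq; rewrite /wlt /wt !ltxi_pair /wlen /= pq !leEnat !leqnn /=.
rewrite !lexi_cons /=.
by case: (ltgtP (x : B *l 'I_N) y).
Qed.

Lemma wlt_nil (b c : B) i j :
  wlt ([::], (b, i)) (([::], (c, j)) : T) = (b < c)%O || (b == c) && (i < j)%N.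
Proof.
rewrite /wlt /wt !ltxi_pair /wlen /= ltEnat /=.
by case: ltgtP.
Qed.

Lemma wlt_len u v : (wlen u < wlen v)%N -> wlt u v.
Proof.
by move=> uv; rewrite /wlt /wt ltxi_pair leEnat ltnW //= leqNgt uv.
Qed.

Lemma wle_len u v : wle u v -> (wlen u <= wlen v)%N.
Proof. by rewrite wleNgt leqNgt; apply: contra => /wlt_len. Qed.

Lemma wlt_lenF u v : (wlen v < wlen u)%N -> wlt u v = false.
Proof. by move=> vu; apply: contraTF vu => /ltW/wle_len; rewrite leqNgt. Qed.

(** The tails are arbitrary apart from their lengths; this is what makes length bounds enough for
    error terms. *)
Lemma wlt_head x y p q l r : (size p <= size q)%N -> ((x : B *l 'I_N) < y)%O ->
  wlt (x :: p, l) (y :: q, r).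
Proof.
rewrite leq_eqVlt => /orP[/eqP pq xy|pq _]; first by rewrite wlt_cons ?xy.
by apply: wlt_len.
Qed.

Lemma wlt_cons2 x u v : wlt (x :: u.1, u.2) (x :: v.1, v.2) = wlt u v.
Proof.
case: u v => [p l] [q r] /=; case: (ltngtP (size p) (size q)) => pq.
- by rewrite !wlt_len.
- by rewrite !wlt_lenF.
- by rewrite wlt_cons // eqxx ltxx.
Qed.

Lemma wlt_wmul p u v : wlt (wmul p u) (wmul p v) = wlt u v.
Proof.
elim: p => [|x p IH]; first by case: u v => [? ?] [? ?].
by rewrite -IH; exact: (wlt_cons2 x (wmul p u) (wmul p v)).
Qed.

Lemma wlt_wD u v i : wlt (wD u i) (wD v i) = wlt u v.
Proof.
case: u v => [p [b j]] [q [c l]]; rewrite /wD /=.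
elim: p q => [|x p IH] [|y q].
- by rewrite !wlt_nil ltn_add2r.
- by rewrite !wlt_len.
- by rewrite !wlt_lenF.
case: (ltngtP (size p) (size q)) => pq.
- by rewrite !wlt_len.
- by rewrite !wlt_lenF.
- by rewrite !wlt_cons // IH.
Qed.

Lemma lt_letter (b : B) (j n : 'I_N) :
  (j < n)%N -> (((b, j) : B *l 'I_N) < (b, n))%O.
Proof. by move=> jn; rewrite ltxi_pair lexx /=. Qed.

Lemma le_letter (x : B * 'I_N) (j : 'I_N) :
  (j <= x.2)%N -> (((x.1, j) : B *l 'I_N) <= x)%O.
Proof. by case: x => b n jn; rewrite lexi_pair lexx. Qed.

(** Three nested inductions: on the length, on the first pair (letter, index), and on the
    accessibility of the tail, which is one letter shorter. *)
Lemma wlt_wf : well_founded (fun x y : B => (x < y)%O) -> well_founded wlt.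
Proof.
move=> B_wf.
have L_wf : well_founded (fun x y : B *l 'I_N => (x < y)%O).
  case=> b; elim/(well_founded_ind B_wf): b => b IHb [n]; elim/ltn_ind: n => n IHn lt_n.
  constructor=> -[c m]; rewrite ltxi_pair => /andP[].
  rewrite le_eqVlt => /predU1P[->|cb _].
    by rewrite lexx /= => mn; case: m mn => m lt_m mn; apply: IHn.
  exact: IHb.
have nil_wf l : Acc wlt ([::], l).
  case: l => b; elim/(well_founded_ind B_wf): b => b IHb i; elim/ltn_ind: i => i IHi.
  constructor=> -[[|y q] [c j]]; last by move/ltW/wle_len.
  by rewrite wlt_nil => /orP[cb|/andP[/eqP-> ji]]; [apply: IHb | apply: IHi].
suff H n : forall u, wlen u = n.+1 -> Acc wlt u by move=> u; apply: (H (size u.1)).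
elim/ltn_ind: n => n IH [[|x p] l] E; first exact: nil_wf.
case: n E IH => [|n] /succn_inj sp IH; first by discriminate sp.
have {}sp : size p = n by apply: succn_inj.
elim/(well_founded_ind L_wf): x p l sp => x IHx p l sp.
have : Acc wlt (p, l) by apply: (IH n); rewrite // /wlen /= sp.
move E : (p, l) => u Au; elim: Au p l sp E => {}u _ IHu p l sp E.
constructor=> -[[|y q] r] lt_q; first exact: nil_wf.
have := wle_len (ltW lt_q); rewrite /wlen /= !ltnS sp leq_eqVlt => /predU1P[sq|sq].
  have sqp : size q = size p by rewrite sq sp.
  move: lt_q; rewrite (wlt_cons _ _ _ _ sqp) => /orP[yx|/andP[/eqP-> qp]].
    exact: (IHx y yx q r sq).
  by rewrite -E in IHu; exact: (IHu (q, r) qp q r sq (erefl _)).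
exact: (IH (size q).+1 sq (y :: q, r) (erefl _)).
Qed.

Lemma wle_total u v : wle u v || wle v u. Proof. exact: le_total. Qed.

Lemma wle_max (s : seq T) : s != [::] ->
  exists2 u, u \in s & forall v, v \in s -> wle v u.
Proof.
elim: s => // u s IH _; have [->|/IH[v vs vmax]] := eqVneq s [::].
  by exists u => [|v]; rewrite inE // => /eqP->; apply: wle_refl.
have [uv|vu] := orP (wle_total u v).
  exists v => [|w]; rewrite inE ?vs ?orbT // => /predU1P[->//|].
  exact: vmax.
exists u => [|w]; rewrite inE ?eqxx // => /predU1P[->|/vmax wv].
  exact: wle_refl.
exact: wle_trans vu.
Qed.

End WordOrder.

(** * A model with independent normal words *)

Section Model.
Context {k : fieldType} {disp : Order.disp_t} {B : orderType disp} (N : nat).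

Local Notation letter := (B * nat)%type.
Local Notation K := (seq (B * nat) * nat)%type.

(* The free module on K is kept abstract, as unification would otherwise unfold
   its construction. The monomial e (w, i) stands for D^i w, and the letter
   (b, j) for d^j b. *)
Context (M : lmodType k) (e : K -> M) (lext : (K -> M) -> {linear M -> M})
  (cf : K -> {linear M -> k^o}).
Hypothesis lextU : forall h m, lext h (e m) = h m.
Hypothesis cfU : forall j m, cf j (e m) = (m == j)%:R.
Hypothesis cf_inj : forall x, (forall j, cf j x = 0) -> x = 0.
Hypothesis e_span : forall x, lspan (fun y => exists m, y = e m) x.

(** Linearity is a proposition here, so that anonymous functions of the left factor can be compared
    on monomials. *)
Lemma linear_e_eq (V : lmodType k) (f g : M -> V) : linear f -> linear g ->
  (forall m, f (e m) = g (e m)) -> f =1 g.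
Proof.
move=> fl gl fg x.
have l0 (h : M -> V) : linear h -> h 0 = 0.
  by move=> hl; have := hl (-1) 0 0; rewrite scaler0 addr0 scaleN1r addNr.
elim: (e_span x) => [|c _ y [m ->] _ IH]; first by rewrite !l0.
by rewrite fl gl fg IH.
Qed.

Implicit Types (f g y z : M) (x : letter) (w : seq letter).

Definition lmulw w : M -> M :=
  lext (fun m : K => e (w ++ m.1, m.2)).
HB.instance Definition _ w := GRing.Linear.on (lmulw w).

(** The product (d x) z for a letter x; the truncation is the relation d^N b = 0. *)
Definition incl x z : M :=
  if (x.2.+1 < N)%N then lmulw [:: (x.1, x.2.+1)] z else 0.

(** The Leibniz rule for d + d/dD on D^i w. For i = 0 the junk exponent [i.-1] is multiplied by
    0. *)
Fixpoint dmon w i : M :=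
  if w is x :: w' then incl x (e (w', i)) + lmulw [:: x] (dmon w' i)
  else e ([::], i.-1) *+ i.

(* d + d/dD *)
Definition dmod : M -> M := lext (fun m : K => dmon m.1 m.2).
HB.instance Definition _ := GRing.Linear.on dmod.

Definition Dmod : M -> M :=
  lext (fun m : K => e (m.1, m.2.+1)).
HB.instance Definition _ := GRing.Linear.on Dmod.

Lemma lmulwU w v i : lmulw w (e (v, i)) = e (w ++ v, i).
Proof. exact: lextU. Qed.

Lemma dmodU w i : dmod (e (w, i)) = dmon w i.
Proof. exact: lextU. Qed.

Lemma DmodU w i : Dmod (e (w, i)) = e (w, i.+1).
Proof. exact: lextU. Qed.

Definition dpow n : M -> M := iter n dmod.

Lemma dpow_linear n : linear (dpow n).
Proof. by rewrite /dpow; elim: n => [|n IH] c y z //=; rewrite IH linearP. Qed.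
HB.instance Definition _ n := GRing.isLinear.Build k M M *:%R
  (dpow n) (dpow_linear n).

Lemma incl_linear x : linear (incl x).
Proof.
by move=> c y z; rewrite /incl; case: ifP; rewrite ?linearP // scaler0 addr0.
Qed.
HB.instance Definition _ x := GRing.isLinear.Build k M M *:%R
  (incl x) (incl_linear x).

Lemma lmulw0 y : lmulw [::] y = y.
Proof.
apply: (@linear_e_eq M (lmulw [::]) id); [exact: linearP | by [] |].
by case=> w i; rewrite lmulwU.
Qed.

Lemma lmulw_cat w v y : lmulw (w ++ v) y = lmulw w (lmulw v y).
Proof.
apply: (@linear_e_eq M (lmulw (w ++ v)) (lmulw w \o lmulw v));
  [exact: linearP | exact: linearP |].
by case=> u i /=; rewrite !lmulwU catA.
Qed.

Lemma dmod_lmul1 x y : dmod (lmulw [:: x] y) = incl x y + lmulw [:: x] (dmod y).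
Proof.
apply: (@linear_e_eq M (dmod \o lmulw [:: x])
  (fun y => incl x y + lmulw [:: x] (dmod y))); [exact: linearP| |].
  by move=> c u v; rewrite !linearP /= scalerDr addrACA.
by case=> u i /=; rewrite lmulwU !dmodU.
Qed.

Lemma Dmod_lmulw w y : Dmod (lmulw w y) = lmulw w (Dmod y).
Proof.
apply: (@linear_e_eq M (Dmod \o lmulw w) (lmulw w \o Dmod));
  [exact: linearP | exact: linearP |].
by case=> u i /=; rewrite lmulwU !DmodU lmulwU.
Qed.

(** Since d commutes with D and [d/dD, D] = 1. The behaviour of the products under D rests on this
    commutator. *)
Lemma dmod_Dmod y : dmod (Dmod y) = Dmod (dmod y) + y.
Proof.
apply: (@linear_e_eq M (dmod \o Dmod) (fun y => Dmod (dmod y) + y));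
  [exact: linearP | by move=> c u v; rewrite !linearP /= scalerDr addrACA |].
case=> w i /=; rewrite DmodU !dmodU; elim: w => [|x w IH] /=.
  case: i => [|i]; first by rewrite mulr0n linear0 add0r.
  by rewrite linearMn /= DmodU -mulrSr.
rewrite linearD /= Dmod_lmulw IH linearD /= lmulwU addrA; congr (_ + _ + _).
by rewrite /incl; case: ifP; rewrite ?linear0 // !lmulwU DmodU.
Qed.

Lemma dpow_Dmod n y :
  dpow n (Dmod y) = Dmod (dpow n y) + dpow n.-1 y *+ n.
Proof.
elim: n => [|n IH]; first by rewrite mulr0n addr0.
rewrite [LHS]/= -/(dpow n _) IH linearD /= dmod_Dmod -addrA; congr (_ + _).
rewrite linearMn /=; case: n {IH} => [|n]; first by rewrite mulr0n addr0.
by rewrite [RHS]mulrS.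
Qed.

(** The value of (D^i w)_(n) y forced by (Da)_(n) y = - n a_(n-1) y. The falling factorial vanishes
    for n < i, where the subtraction is truncated. *)
Definition nmon n (m : K) y : M :=
  ((-1) ^+ m.2 * (n ^_ m.2)%:R : k) *: lmulw m.1 (dpow (n - m.2) y).

(* The factor makes the products vanish when N = 0; it is 1 otherwise. *)
Definition nmod n f y : M :=
  ((0 < N)%:R : k) *: lext (fun m : K => nmon n m y) f.

Lemma nmodU n m y : nmod n (e m) y = ((0 < N)%:R : k) *: nmon n m y.
Proof. by rewrite /nmod lextU. Qed.

Lemma nmod_linear_l n y : linear (nmod n ^~ y).
Proof.
by move=> c f g /=; rewrite /nmod linearP scalerDr !scalerA mulrC.
Qed.

Lemma nmod_0l n y : nmod n 0 y = 0.
Proof. by rewrite /nmod linear0 scaler0. Qed.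

Lemma nmod_linDl n f g y : nmod n (f + g) y = nmod n f y + nmod n g y.
Proof. by rewrite /nmod linearD scalerDr. Qed.

Lemma nmodZl n c f y : nmod n (c *: f) y = c *: nmod n f y.
Proof. by rewrite /nmod linearZ /= !scalerA mulrC. Qed.

Lemma nmodMnl n f i y : nmod n (f *+ i) y = nmod n f y *+ i.
Proof. by rewrite /nmod linearMn scalerMnr. Qed.

Lemma nmon_linear n m : linear (nmon n m).
Proof.
by move=> c y z; rewrite /nmon !linearP.
Qed.

Lemma nmod_linear_r n f : linear (nmod n f).
Proof.
move=> c y z; rewrite /nmod.
have -> : lext (fun m => nmon n m (c *: y + z)) f =
    c *: lext (fun m => nmon n m y) f + lext (fun m => nmon n m z) f.
  apply: (@linear_e_eq M (lext (fun m => nmon n m (c *: y + z)))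
    (fun f => c *: lext (fun m => nmon n m y) f + lext (fun m => nmon n m z) f)).
  - exact: linearP.
  - move=> d u v; rewrite !linearP /= !scalerA [c * d]mulrC.
    by rewrite addrACA.
  - by move=> m; rewrite !lextU nmon_linear.
by rewrite scalerDr !scalerA mulrC.
Qed.

(* Each application of [dmod] raises an index below N or lowers the power of D. *)
Lemma dpow_dmon w i : exists n, forall n', (n <= n')%N -> dpow n' (e (w, i)) = 0.
Proof.
pose pot w i := (\sum_(x <- w) (N - x.2) + i)%N.
suff H n : forall w i, (pot w i < n)%N -> dpow n (e (w, i)) = 0.
  by exists (pot w i).+1 => n' lt_n'; apply: H.
elim: n => // n IH {}w {}i le_n.
rewrite /dpow iterSr -/(dpow n _) dmodU.
(* The prefix [v] collects the letters that the Leibniz expansion has already passed. *)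
suff H v : (pot (v ++ w) i < n.+1)%N -> dpow n (lmulw v (dmon w i)) = 0.
  by rewrite -[dmon w i]lmulw0 H.
elim: w v {le_n} => [|x w IHw] v.
  rewrite /= 2!linearMn /= lmulwU; case: i => [|i] le_n; first by rewrite mulr0n.
  by rewrite /= IH ?mul0rn //; move: le_n; rewrite /pot addnS.
rewrite -cat_rcons /= => le_n; rewrite 2!linearD /= -lmulw_cat cats1 IHw // addr0.
rewrite /incl; case: ifP => [lt_x|]; last by rewrite !linear0.
rewrite !lmulwU IH //; move: le_n; rewrite /pot cat_rcons !big_cat /= !big_cons /=.
by rewrite big_nil; lia.
Qed.

Lemma dpow_eq0 y : exists n, forall n', (n <= n')%N -> dpow n' y = 0.
Proof.
elim: (e_span y) => [|c _ z [[w i] ->] _ [n1 IH1]].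
  by exists 0%N => n _; rewrite linear0.
have [n2 IH2] := dpow_dmon w i; exists (maxn n1 n2) => n'; rewrite geq_max.
by case/andP=> le1 le2; rewrite dpow_linear IH1 // IH2 // scaler0 addr0.
Qed.

Lemma nmod_local f y : exists n0, forall n, (n0 <= n)%N -> nmod n f y = 0.
Proof.
have [n0 y0] := dpow_eq0 y.
elim: (e_span f) => [|c _ z [[w i] ->] _ [n1 IH1]].
  by exists 0%N => n _; rewrite /nmod linear0 scaler0.
exists (n0 + i + n1)%N => n le_n; rewrite nmod_linear_l IH1; last by lia.
by rewrite nmodU /nmon y0 ?linear0 ?scaler0 ?addr0 //=; lia.
Qed.

Lemma Dmod_nmod n f y :
  Dmod (nmod n f y) = nmod n (Dmod f) y + nmod n f (Dmod y).
Proof.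
apply: (@linear_e_eq M (fun f => Dmod (nmod n f y))
  (fun f => nmod n (Dmod f) y + nmod n f (Dmod y))).
- by move=> c u v; rewrite nmod_linear_l linearP.
- by move=> c u v; rewrite linearP /= !nmod_linear_l scalerDr addrACA.
case=> w i; rewrite DmodU !nmodU linearZ -scalerDr /=; congr (_ *: _).
rewrite /nmon /= linearZ /= Dmod_lmulw dpow_Dmod linearD scalerDr addrCA.
rewrite -[LHS]addr0; congr (_ + _); apply/esym.
rewrite linearMn /= subnS -[lmulw _ _ *+ _]scaler_nat scalerA -scalerDl.
rewrite exprS ffactnSr natrM [X in X *: _](_ : _ = 0) ?scale0r //; ring.
Qed.

Lemma nmod0_Dmod f y : nmod 0 (Dmod f) y = 0.
Proof.
apply: (@linear_e_eq M (fun f => nmod 0 (Dmod f) y) (fun=> 0)).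
- by move=> c u v; rewrite linearP /= nmod_linear_l.
- by move=> c u v; rewrite scaler0 addr0.
by case=> w i; rewrite DmodU nmodU /nmon /= mulr0 scale0r scaler0.
Qed.

Lemma nmodS_Dmod n f y : nmod n.+1 (Dmod f) y = - (nmod n f y *+ n.+1).
Proof.
apply: (@linear_e_eq M (fun f => nmod n.+1 (Dmod f) y)
  (fun f => - (nmod n f y *+ n.+1))).
- by move=> c u v; rewrite linearP /= nmod_linear_l.
- by move=> c u v; rewrite nmod_linear_l mulrnDl opprD scalerN scalerMnr.
case=> w i; rewrite DmodU !nmodU /nmon /= subSS -scaler_nat !scalerA -scaleNr.
by congr (_ *: _); rewrite exprS ffactSS natrM; ring.
Qed.

Lemma nmod_lmulw n w f y : nmod n (lmulw w f) y = lmulw w (nmod n f y).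
Proof.
apply: (@linear_e_eq M (fun f => nmod n (lmulw w f) y)
  (fun f => lmulw w (nmod n f y))).
- by move=> c u v; rewrite linearP /= nmod_linear_l.
- by move=> c u v; rewrite nmod_linear_l linearP.
case=> v i; rewrite lmulwU !nmodU /nmon /= lmulw_cat [RHS]linearZ /=.
by congr (_ *: _); rewrite [RHS]linearZ.
Qed.

(** With E = [dmod] and a_(m) y = a E^m y for a word a, this is the Leibniz rule (E a) E^m y = E (a
    E^m y) - a E^(m+1) y. Powers of D are the base case, an identity between falling factorials. *)
Lemma nmod_dmod m f y :
  nmod m (dmod f) y = dmod (nmod m f y) - nmod m.+1 f y.
Proof.
apply: (@linear_e_eq M (fun f => nmod m (dmod f) y)
  (fun f => dmod (nmod m f y) - nmod m.+1 f y)).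
- by move=> c u v; rewrite linearP /= nmod_linear_l.
- by move=> c u v; rewrite !nmod_linear_l linearP /= scalerBr opprD addrACA.
case=> w i; rewrite dmodU; elim: w => [|x w IH] /=.
  rewrite nmodMnl !nmodU /nmon /= !lmulw0.
  rewrite [dmod (_ *: _)]linearZ /= [dmod (_ *: _)]linearZ /= -scalerBr scalerMnr.
  congr (_ *: _); case: i => [|i].
    by rewrite !expr0 !ffactn0 !mulr1 !scale1r !subn0 mulr0n subrr.
  rewrite subSS -scaler_nat scalerA /=.
  have [lt_mi|le_im] := ltnP m i.
    by rewrite !ffact_small ?mulr0 ?scale0r ?subrr //; lia.
  (* At m = i the exponent m - (i + 1) is truncated, but its coefficient is zero. *)
  have [eq_mi|ne_mi] := eqVneq m i.
    rewrite eq_mi ffactnSr subnn muln0 mulr0 scale0r sub0r -scaleNr.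
    by congr (_ *: _); rewrite exprS ffactSS natrM; ring.
  have -> : dmod (dpow (m - i.+1) y) = dpow (m - i) y.
    by rewrite -[LHS]/(dpow (m - i.+1).+1 y); congr dpow; lia.
  rewrite -scalerBl; congr (_ *: _); rewrite exprS ffactSS ffactnSr !natrM.
  by rewrite natrB // -[m.+1]addn1 -[i.+1]addn1 !natrD; ring.
rewrite nmod_linDl -[in RHS](lmulwU [:: x] w i) !nmod_lmulw IH dmod_lmul1.
by rewrite linearB /= addrA; congr (_ + _ - _); rewrite /incl; case: ifP;
  rewrite ?nmod_0l ?nmod_lmulw.
Qed.

(** By [nmod_dmod], [dmod] on the left factor is the difference of two commuting operations, [dmod]
    on the product and the shift of the index; the sum is the binomial theorem. The free bound [L]
    serves associativity, where the exponent is n - i but the sum runs up to n. *)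
Lemma nmod_dpow m n f y L : (n < L)%N ->
  nmod m (dpow n f) y =
  \sum_(t < L) ((-1) ^+ t * 'C(n, t)%:R : k) *: dpow (n - t) (nmod (m + t) f y).
Proof.
move=> lt_nL.
suff -> : nmod m (dpow n f) y = \sum_(t < n.+1)
    ((-1) ^+ t * 'C(n, t)%:R : k) *: dpow (n - t) (nmod (m + t) f y).
  rewrite (big_ord_widen L (fun t => ((-1) ^+ t * 'C(n, t)%:R : k) *:
    dpow (n - t) (nmod (m + t) f y)) lt_nL) big_mkcond; apply: eq_bigr => t _.
  by case: ltnP => // ?; rewrite bin_small // mulr0 scale0r.
elim: n m {L lt_nL} => [|n IH] m.
  by rewrite big_ord1 expr0 bin0 mulr1 scale1r addn0.
rewrite [dpow n.+1 f]/(dmod (dpow n f)) nmod_dmod !IH [RHS]big_ord_recl /=.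
rewrite linear_sum big_ord_recl /= !bin0 !expr0 !mulr1 !scale1r !subn0 -addrA.
congr (_ + _).
under [RHS]eq_bigr => t _ do
  rewrite /= /bump /= add1n subSS exprS binS natrD mulrDr scalerDl.
rewrite [RHS]big_split /= -sumrN; congr (_ + _).
  rewrite [RHS]big_ord_recr /= bin_small // mulr0 scale0r addr0.
  apply: eq_bigr => t _; rewrite linearZ /= /bump /= add1n exprS; congr (_ *: _).
  by rewrite -[LHS]/(dpow (n - t.+1).+1 _); congr dpow; have := ltn_ord t; lia.
apply: eq_bigr => t _; rewrite -scaleNr addSnnS; congr (_ *: _); ring.
Qed.

Lemma ffact_bin n i t : (n ^_ i * 'C(n - i, t) = 'C(n, t) * (n - t) ^_ i)%N.
Proof.
elim: i => [|i IH]; first by rewrite !ffactn0 subn0 mul1n muln1.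
rewrite !ffactnSr subnS -mulnA mul_bin_down mulnCA IH subnAC; lia.
Qed.

Lemma nmodA n m f g y :
  nmod m (nmod n f g) y =
  \sum_(t < n.+1)
    ((-1) ^+ t * 'C(n, t)%:R : k) *: nmod (n - t)%N f (nmod (m + t)%N g y).
Proof.
apply: (@linear_e_eq M (fun f => nmod m (nmod n f g) y)
  (fun f => \sum_(t < n.+1)
    ((-1) ^+ t * 'C(n, t)%:R : k) *: nmod (n - t)%N f (nmod (m + t)%N g y))).
- by move=> c u v; rewrite !nmod_linear_l.
- move=> c u v; rewrite scaler_sumr -big_split; apply: eq_bigr => t _ /=.
  by rewrite nmod_linear_l scalerDr !scalerA [c * _]mulrC.
case=> w i; rewrite nmodU /nmon /= !nmodZl nmod_lmulw (@nmod_dpow _ _ _ _ n.+1).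
  rewrite linear_sum !scaler_sumr; apply: eq_bigr => t _ /=.
  rewrite [lmulw _ (_ *: _)]linearZ nmodU /nmon /= !scalerA subnAC.
  congr (_ *: _); have := ffact_bin n i t => /(congr1 (fun j => j%:R : k)).
  rewrite !natrM => E.
  transitivity ((0 < N)%:R * (-1) ^+ i * (-1) ^+ t *
    ((n ^_ i)%:R * 'C(n - i, t)%:R) : k); first by ring.
  by rewrite E; ring.
by rewrite ltnS leq_subr.
Qed.

Definition tl x : M -> M := lext (fun m : K =>
  if m.1 is y :: w then if y == x then e (w, m.2) else 0 else 0).
HB.instance Definition _ x := GRing.Linear.on (tl x).

Lemma tlU x w i :
  tl x (e (w, i)) = if w is y :: w then if y == x then e (w, i) else 0 else 0.
Proof. exact: lextU. Qed.

Lemma cf_lmul1 (x y : letter) w i z :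
  cf (y :: w, i) (lmulw [:: x] z) = if x == y then cf (w, i) z else 0.
Proof.
apply: (@linear_e_eq k^o (fun z => cf (y :: w, i) (lmulw [:: x] z))
  (fun z => if x == y then cf (w, i) z else 0)).
- by move=> c u v; rewrite !linearP.
- by move=> c u v; case: ifP; rewrite ?linearP // scaler0 addr0.
case=> v j; rewrite lmulwU !cfU /= !xpair_eqE /= eqseq_cons.
by case: (x == y).
Qed.

Lemma cf_lmul1_nil x i z : cf ([::], i) (lmulw [:: x] z) = 0.
Proof.
apply: (@linear_e_eq k^o (fun z => cf ([::], i) (lmulw [:: x] z)) (fun=> 0)).
- by move=> c u v; rewrite !linearP.
- by move=> c u v; rewrite scaler0 addr0.
by case=> v j; rewrite lmulwU cfU.
Qed.

Lemma cf_tl x w i z : cf (w, i) (tl x z) = cf (x :: w, i) z.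
Proof.
apply: (@linear_e_eq k^o (fun z => cf (w, i) (tl x z)) (cf (x :: w, i))).
- by move=> c u v; rewrite !linearP.
- exact: linearP.
case=> -[|y v] j; rewrite tlU ?linear0 ?cfU //.
by rewrite !xpair_eqE /= eqseq_cons; case: (y == x); rewrite ?cfU ?linear0.
Qed.

(** A monomial with head d^j b arises either by differentiating a head d^(j-1) b or by acting behind
    an unchanged head; [tl] is left division by that head. *)
Lemma cf_dmod_cons x w i z :
  cf (x :: w, i) (dmod z) =
  (if (0 < x.2 < N)%N then cf ((x.1, x.2.-1) :: w, i) z else 0) +
  cf (w, i) (dmod (tl x z)).
Proof.
apply: (@linear_e_eq k^o (fun z => cf (x :: w, i) (dmod z))
  (fun z => (if (0 < x.2 < N)%N then cf ((x.1, x.2.-1) :: w, i) z else 0) +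
  cf (w, i) (dmod (tl x z)))).
- by move=> c u v; rewrite !linearP.
- move=> c u v; rewrite !linearP /=; case: ifP; rewrite ?linearP /=.
    by rewrite addrACA scalerDr.
  by rewrite !add0r.
case=> -[|y v] j; rewrite dmodU tlU /=.
  rewrite linearMn /= cfU mul0rn !linear0 addr0 cfU /=.
  by case: ifP.
rewrite linearD /= cf_lmul1; congr (_ + _); last first.
  by case: eqP => _; rewrite ?dmodU ?linear0.
rewrite /incl cfU /=; case: x y => [b n] [c l] /=.
case: ifP => lN; rewrite ?linear0 ?lmulwU ?cfU /= !xpair_eqE !eqseq_cons !xpair_eqE.
  case: n => [|n] /=; first by rewrite andbF.
  rewrite eqSS; case: ifP => // nN; case: (l =P n) => [ln|]; rewrite ?andbF //.
  by rewrite -ln lN in nN.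
case: ifP => // /andP[n0 nN]; case: (l =P n.-1) => [ln|]; rewrite ?andbF //.
by move: lN; rewrite ln prednK // nN.
Qed.

Lemma cf_dmod_nil i z : cf ([::], i) (dmod z) = cf ([::], i.+1) z *+ i.+1.
Proof.
apply: (@linear_e_eq k^o (fun z => cf ([::], i) (dmod z))
  (fun z => cf ([::], i.+1) z *+ i.+1)).
- by move=> c u v; rewrite !linearP.
- by move=> c u v; rewrite linearP mulrnDl scalerMnr.
case=> -[|y v] j; rewrite dmodU /=.
  rewrite linearMn /= !cfU; case: j => [|j]; first by rewrite mul0rn.
  by rewrite !xpair_eqE /= eqSS; case: eqP => [->|]; rewrite // !mul0rn.
rewrite linearD /= cf_lmul1_nil addr0 cfU mul0rn /incl.
by case: ifP; rewrite ?cf_lmul1_nil ?linear0.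
Qed.

Definition homog l z := forall w i, size w != l -> cf (w, i) z = 0.

Lemma homog_dmod l z : homog l z -> homog l (dmod z).
Proof.
move=> hz w; elim: w l z hz => [|x w IH] l z hz i ne_l.
  by rewrite cf_dmod_nil hz // mul0rn.
rewrite cf_dmod_cons hz //; case: l hz ne_l => [|l] hz ne_l.
  have -> : tl x z = 0 by apply: cf_inj => -[v j]; rewrite cf_tl hz.
  by rewrite !linear0 addr0; case: ifP.
rewrite (IH l) ?addr0; first by case: ifP.
- by move=> v j ne_v; rewrite cf_tl hz.
- by [].
Qed.

Lemma homog_dpow l n z : homog l z -> homog l (dpow n z).
Proof. by move=> hz; elim: n => //= n IH; apply: homog_dmod. Qed.

Definition head_le j z :=
  forall b n w i, (j < n)%N -> cf ((b, n) :: w, i) z = 0.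

Lemma head_le_dmod j z : head_le j z -> head_le j.+1 (dmod z).
Proof.
move=> hz b n w i lt_jn; rewrite cf_dmod_cons /=.
have -> : tl (b, n) z = 0.
  by apply: cf_inj => -[v l]; rewrite cf_tl hz // ltnW.
rewrite !linear0 addr0 hz; last by lia.
by case: ifP.
Qed.

Lemma head_le_dpow n z : head_le 0 z -> head_le n (dpow n z).
Proof. by move=> hz; elim: n => //= n IH; apply: head_le_dmod. Qed.

(** Each [dmod] raises the order of the head by at most one, so reaching order n in n steps spends
    every step on the head. There is one way to do so, hence no binomial factor. *)
Lemma cf_dpow_head n z b w i : head_le 0 z -> (n < N)%N ->
  cf ((b, n) :: w, i) (dpow n z) = cf ((b, 0%N) :: w, i) z.
Proof.
move=> hz; elim: n => // n IH lt_nN; rewrite -IH 1?ltnW //.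
rewrite [dpow n.+1 z]/(dmod (dpow n z)) cf_dmod_cons /= lt_nN.
have -> : tl (b, n.+1) (dpow n z) = 0.
  by apply: cf_inj => -[v l]; rewrite cf_tl head_le_dpow.
by rewrite !linear0 addr0.
Qed.

Local Notation T := (word B N).

(** The indices are shifted by one place: in b_(n) y the index n becomes the order of the derivative
    on the first letter of y. *)
Fixpoint key_letters (p : multiplier B N) (b : B) (j : nat) : seq letter :=
  if p is x :: p' then (x.1, j) :: key_letters p' b x.2 else [:: (b, j)].

Definition key (u : T) : K := (key_letters u.1 u.2.1 0, u.2.2).

Definition nwm (u : T) : M :=
  foldr (fun (bn : B * 'I_N) y => nmod bn.2 (e ([:: (bn.1, 0%N)], 0%N)) y)
    (e ([:: (u.2.1, 0%N)], u.2.2)) u.1.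

Lemma nwm_cons (x : B * 'I_N) u :
  nwm (x :: u.1, u.2) = lmulw [:: (x.1, 0%N)] (dpow x.2 (nwm u)).
Proof.
case: x => b [n lt_n]; rewrite /nwm /= nmodU /nmon /= (leq_ltn_trans _ lt_n) //.
by rewrite !scale1r subn0 expr0 mulr1 scale1r.
Qed.

Lemma head_le_nwm u : head_le 0 (nwm u).
Proof.
case: u => -[|x p] l b n w i lt_n.
  by rewrite cfU xpair_eqE eqseq_cons xpair_eqE /= ltn_eqF // andbF.
rewrite (nwm_cons x (p, l)) cf_lmul1 xpair_eqE.
by rewrite ltn_eqF // andbF.
Qed.

Lemma homog_nwm u : homog (wlen u) (nwm u).
Proof.
case: u => p l; elim: p => [|x p IH] w i ne_w.
  rewrite cfU xpair_eqE; case: w ne_w => [|y [|z w]] //=; rewrite ?eqseq_cons ?andbF //.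
rewrite (nwm_cons x (p, l)); case: w ne_w => [|y w] ne_w; first exact: cf_lmul1_nil.
by rewrite cf_lmul1 (homog_dpow _ IH) //; case: ifP.
Qed.

Lemma size_key_letters p b j : size (key_letters p b j) = (size p).+1.
Proof. by elim: p j => //= x p IH j; rewrite IH. Qed.

Lemma key_letters0 p b :
  exists c w, forall j, key_letters p b j = (c, j) :: w.
Proof. by case: p => [|x p] /=; do 2!eexists. Qed.

Lemma key_cons (x : B * 'I_N) p l :
  key (x :: p, l) = ((x.1, 0%N) :: key_letters p l.1 x.2, l.2).
Proof. by []. Qed.

Lemma cf_key_nwm u : cf (key u) (nwm u) = 1.
Proof.
case: u => p l; elim: p => [|x p IH]; first by rewrite cfU eqxx.
rewrite (nwm_cons x (p, l)) key_cons cf_lmul1 eqxx.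
have [c [w E]] := key_letters0 p l.1; move: IH; rewrite /key !E => <-.
by rewrite cf_dpow_head ?ltn_ord //; exact: head_le_nwm.
Qed.

(** Different lengths are separated by homogeneity. For equal lengths the first difference decides:
    different letters give different monomials, and if the index m of [v] is below the index n of
    [u], then m applications of [dmod] cannot bring the next letter to order n. *)
Lemma cf_key_nwm_lt u v : wlt v u -> cf (key u) (nwm v) = 0.
Proof.
have [ne_len|/negPn/eqP] := boolP (wlen u != wlen v).
  by move=> _; apply: homog_nwm; rewrite size_key_letters.
case: u v => [p l] [q r] /succn_inj; elim: p q => [|x p IH] [|y q] //.
  case: l r => b i [c j] _; rewrite wlt_nil cfU xpair_eqE eqseq_cons xpair_eqE /=.
  case/orP => [|/andP[_]] lt; first by rewrite lt_eqF.
  by rewrite [_ == i]ltn_eqF ?andbF.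
move=> /succn_inj sz; rewrite (wlt_cons _ _ _ _ (esym sz)) (nwm_cons y (q, r)).
rewrite key_cons cf_lmul1 xpair_eqE andbT.
case: (y.1 =P x.1) => // Eb; have [c [w E]] := key_letters0 p l.1.
case: x y Eb => b n [b' m] /= ->; rewrite ltxi_pair lexx /=.
rewrite xpair_eqE eqxx /= => /orP[lt|/andP[/eqP-> lt]].
  by rewrite E head_le_dpow //; apply: head_le_nwm.
rewrite E cf_dpow_head ?ltn_ord //; last exact: head_le_nwm.
by have := IH q sz lt; rewrite /key E.
Qed.

Lemma dpow_letter n (b : B) : (0 < N)%N ->
  dpow n (e ([:: (b, 0%N)], 0%N)) = if (n < N)%N then e ([:: (b, n)], 0%N) else 0.
Proof.
move=> N0; elim: n => [|n IH]; first by rewrite N0.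
rewrite -[LHS]/(dmod (dpow n (e ([:: (b, 0%N)], 0%N)))) IH.
case: (ltnP n N) => [lt_n|le_n].
  rewrite dmodU /= mulr0n linear0 addr0 /incl /=.
  by case: ifP; rewrite // lmulwU.
by rewrite linear0 ltnNge (leq_trans le_n).
Qed.

Lemma model_triangular :
  exists (C : assocConfAlgType k) (eps : B -> C) (cf : T -> C -> k),
    [/\ forall a b n, (N <= n)%N -> nprod n (eps a) (eps b) = 0,
        forall u c (f g : C), cf u (c *: f + g) = c * cf u f + cf u g,
        forall u, cf u (nw eps u) = 1
      & forall u v, wlt v u -> cf u (nw eps v) = 0].
Proof.
pose confM := Lmodule_isConformal.Build k M nmod_linear_l nmod_linear_r
  (linearP Dmod) nmod_local Dmod_nmod nmod0_Dmod nmodS_Dmod.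
pose C0 : confAlgType k := HB.pack (GRing.Lmodule.sort M) confM.
pose assocM := ConfAlg_isAssoc.Build k C0 nmodA.
pose C : assocConfAlgType k := HB.pack (GRing.Lmodule.sort M) confM assocM.
pose eps (b : B) : C := e ([:: (b, 0%N)], 0%N).
have DE i b : iter i cder (eps b) = e ([:: (b, 0%N)], i).
  by elim: i => //= i ->; apply: DmodU.
have nwE u : nw eps u = nwm u by rewrite /nw DE.
exists C, eps, (fun u => cf (key u)); split.
- move=> a b n le_n; rewrite -[LHS]/(nmod n (e _) (e _)) nmodU /nmon.
  case: (boolP (0 < N)%N) => [N0|_]; last by rewrite scale0r.
  by rewrite subn0 dpow_letter // ltnNge le_n linear0 !scaler0.
- by move=> u c f g; rewrite linearP.
- by move=> u; rewrite nwE; apply: cf_key_nwm.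
- by move=> u v lt_vu; rewrite nwE; apply: cf_key_nwm_lt.
Qed.

End Model.

Lemma free_module_exists (k : fieldType) (K : choiceType) :
  exists (M : lmodType k) (e : K -> M) (lext : (K -> M) -> {linear M -> M})
         (cf : K -> {linear M -> k^o}),
    [/\ forall h m, lext h (e m) = h m,
        forall j m, cf j (e m) = (m == j)%:R,
        forall x, (forall j, cf j x = 0) -> x = 0
      & forall x, lspan (fun y => exists m, y = e m) x].
Proof.
pose M := {malg k[K]}; pose e m : M := << m >>.
have eZ c m : << c *g m >> = c *: e m :> M.
  by apply/malgP=> j; rewrite mcoeffZ !mcoeffU mulrnAr mulr1.
pose lext h (g : M) : M := \sum_(m <- msupp g) g@_m *: h m.
have lextEw h (g : M) (d : {fset K}) :
    (msupp g `<=` d)%fset -> lext h g = \sum_(m <- d) g@_m *: h m.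
  move=> gd; apply: big_fset_incl => // m _ /mcoeff_outdom ->.
  by rewrite scale0r.
have lext_lin h : linear (lext h).
  move=> c f g; pose d := (msupp f `|` msupp g `|` msupp (c *: f + g))%fset.
  rewrite !(@lextEw _ _ d) ?fsubsetUr //; first last.
  - by rewrite /d fsubsetU // fsubsetUl.
  - by rewrite /d fsubsetU // fsubsetUr.
  rewrite scaler_sumr -big_split; apply: eq_bigr => m _ /=.
  by rewrite mcoeffD mcoeffZ scalerDl scalerA.
pose lextL h : {linear M -> M} :=
  HB.pack (lext h) (GRing.isLinear.Build k M M *:%R (lext h) (lext_lin h)).
have cf_lin j : linear (mcoeff j : M -> k^o).
  by move=> c f g; rewrite mcoeffD mcoeffZ.
pose cf j : {linear M -> k^o} :=
  HB.pack (mcoeff j : M -> k^o)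
    (GRing.isLinear.Build k M k^o *:%R (mcoeff j : M -> k^o) (cf_lin j)).
exists M, e, lextL, cf; split.
- move=> h m; rewrite /= (@lextEw _ _ [fset m]%fset).
    by rewrite big_seq_fset1 mcoeffUU scale1r.
  by rewrite msuppU oner_eq0.
- by move=> j m; rewrite /= mcoeffU.
- by move=> x x0; apply/malgP => j; rewrite mcoeff0; apply: x0.
move=> x; rewrite [x]monalgE; apply: lspan_sum => m _.
by rewrite eZ; apply/lspanZ/lspan_gen; exists m.
Qed.

Lemma triangular_model_exists (k : fieldType) (disp : Order.disp_t)
    (B : orderType disp) (N : nat) :
  exists (C : assocConfAlgType k) (eps : B -> C) (cf : word B N -> C -> k),
    [/\ forall a b n, (N <= n)%N -> nprod n (eps a) (eps b) = 0,
        forall u c x y, cf u (c *: x + y) = c * cf u x + cf u y,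
        forall u, cf u (nw eps u) = 1
      & forall u v, wlt v u -> cf u (nw eps v) = 0].
Proof.
have [M [e [lext [cf [lextU cfU cf_inj e_span]]]]] :=
  free_module_exists k (seq (B * nat) * nat)%type.
exact: (model_triangular _ lextU cfU cf_inj e_span).
Qed.

(** * Products of normal words *)

Section ConformalIdentities.
Context {k : fieldType} {C : assocConfAlgType k}.
Implicit Types (a b c x y : C) (n m : nat).

Lemma nprod_iter_cder i m a b :
  nprod m (iter i cder a) b =
  ((-1) ^+ i * (m ^_ i)%:R : k) *: nprod (m - i)%N a b.
Proof.
elim: i m => [|i IH] m; first by rewrite ffactn0 mulr1 scale1r subn0.
rewrite iterS; case: m => [|m].
  by rewrite nprod0_cder mulr0 scale0r.
rewrite nprodS_cder IH ffactSS natrM subSS -scaler_nat scalerA -scaleNr exprS.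
by congr (_ *: _); rewrite mulrCA mulN1r mulNr.
Qed.

Lemma nprod_cder n a b :
  nprod n a (cder b) = cder (nprod n a b) + nprod n.-1 a b *+ n.
Proof.
rewrite cder_nprod; case: n => [|n]; first by rewrite nprod0_cder mulr0n addr0 add0r.
by rewrite nprodS_cder addrC addNKr.
Qed.

(** Associativity solved for its t = 0 term. The other terms have a smaller outer index, which
    drives inductions on n beyond N. *)
Lemma nprodA_recl n m a b c :
  nprod n a (nprod m b c) = nprod m (nprod n a b) c -
  \sum_(t < n) ((-1) ^+ t.+1 * 'C(n, t.+1)%:R : k) *:
    nprod (n - t.+1)%N a (nprod (m + t.+1)%N b c).
Proof.
rewrite nprodA big_ord_recl /= bin0 expr0 mulr1 scale1r subn0 addn0.
by rewrite addrK.
Qed.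

End ConformalIdentities.

(** * Leading-word estimates common to normal words and normal S-words *)

Section MarkedSpan.
Context {k : fieldType} {disp : Order.disp_t} {B : orderType disp} {N : nat}.
Context {C : assocConfAlgType k} (iota : B -> C).
Hypothesis iota_local : forall a b n, (N <= n)%N -> nprod n (iota a) (iota b) = 0.
Local Notation T := (word B N).
Implicit Types (u v w : T) (p : multiplier B N) (x y z : C) (b : B) (P Q : pred T).

Lemma pmul_linear p : linear (pmul iota p).
Proof. by elim: p => [|bn p IH] c x y //=; rewrite IH linearP. Qed.
HB.instance Definition _ p := GRing.isLinear.Build k C C *:%R
  (pmul iota p) (pmul_linear p).

Lemma pmul_cat p q x : pmul iota (p ++ q) x = pmul iota p (pmul iota q x).
Proof. by rewrite /pmul foldr_cat. Qed.

Definition len_le L : pred T := fun w => (wlen w <= L)%N.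
Definition below w : pred T := fun u => wlt u w.
Definition wcons (bn : B * 'I_N) w : T := (bn :: w.1, w.2).

Lemma wlen_wmul p w : wlen (wmul p w) = (size p + wlen w)%N.
Proof. by rewrite /wlen size_cat addnS. Qed.

Lemma wlen_wD w i : wlen (wD w i) = wlen w. Proof. by []. Qed.

Lemma wlen_wmult v (m : 'I_N) w : wlen (wmul (wmult v m) w) = (wlen v + wlen w)%N.
Proof. by rewrite wlen_wmul size_rcons. Qed.

Lemma wlen_wcons bn w : wlen (wcons bn w) = (wlen w).+1. Proof. by []. Qed.

Lemma wmul_wD p w i : wD (wmul p w) i = wmul p (wD w i). Proof. by []. Qed.

Lemma wmul_wcons bn p w : wmul (bn :: p) w = wcons bn (wmul p w). Proof. by []. Qed.

Lemma wlt_wcons bn u v : wlt (wcons bn u) (wcons bn v) = wlt u v.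
Proof. exact: wlt_cons2. Qed.

Lemma below_wcons bn w u : below w u -> below (wcons bn w) (wcons bn u).
Proof. by rewrite /below wlt_wcons. Qed.

(* X x w reads: x is one of the elements considered, with leading word w. *)
Variable X : C -> T -> Prop.
Definition left_closed :=
  forall x w (bn : B * 'I_N), X x w -> X (nprod bn.2 (iota bn.1) x) (wcons bn w).
Definition mspan P : C -> Prop := lspan (fun x => exists2 w, X x w & P w).

Lemma mspan_gen P x w : X x w -> P w -> mspan P x.
Proof. by move=> Xxw Pw; apply: lspan_gen; exists w. Qed.

Lemma mspan_sub P Q x : subpred P Q -> mspan P x -> mspan Q x.
Proof. by move=> PQ; apply: lspan_mono => y [w Xw /PQ Qw]; exists w. Qed.

Lemma mspan_len L L' x : (L <= L')%N -> mspan (len_le L) x -> mspan (len_le L') x.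
Proof. by move=> LL'; apply: mspan_sub => w /leq_trans; apply. Qed.

Lemma mspan_below_len w L x : (wlen w <= L)%N ->
  mspan (below w) x -> mspan (len_le L) x.
Proof. by move=> wL; apply: mspan_sub => u /ltW/wle_len/leq_trans; apply. Qed.

Lemma mspan_len_below w L x : (L < wlen w)%N ->
  mspan (len_le L) x -> mspan (below w) x.
Proof.
move=> Lw; apply: mspan_sub => u; rewrite /len_le => uL.
exact/wlt_len/(leq_ltn_trans uL).
Qed.

Hypothesis X_left : left_closed.

Lemma mspan_left P Q (bn : B * 'I_N) y : (forall w, P w -> Q (wcons bn w)) ->
  mspan P y -> mspan Q (nprod bn.2 (iota bn.1) y).
Proof.
move=> PQ; apply: lspan_image; first exact: linearP.
by move=> x [w Xw Pw]; apply: (mspan_gen (X_left bn Xw)); apply: PQ.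
Qed.

Lemma mspan_left_len L (bn : B * 'I_N) y :
  mspan (len_le L) y -> mspan (len_le L.+1) (nprod bn.2 (iota bn.1) y).
Proof. exact: mspan_left. Qed.

Lemma mspan_pmul p w y :
  mspan (below w) y -> mspan (below (wmul p w)) (pmul iota p y).
Proof.
move=> yw; elim: p => [|bn p IH]; first by case: w yw.
by apply: mspan_left IH => u; apply: below_wcons.
Qed.

Lemma mspan_pmul_len p L y :
  mspan (len_le L) y -> mspan (len_le (size p + L)) (pmul iota p y).
Proof.
move=> yL; elim: p => [|bn p IH]; first by [].
exact: mspan_left_len.
Qed.

(* A smaller index makes the first letter, hence the whole word, smaller. *)
Lemma mspan_lower_index L b (n : 'I_N) (j : nat) y w : (j < n)%N ->
  (L <= wlen w)%N -> mspan (len_le L) y ->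
  mspan (below (wcons (b, n) w)) (nprod j (iota b) y).
Proof.
move=> jn Lw; have lt_jN := ltn_trans jn (ltn_ord n).
apply: (@mspan_left _ _ (b, Ordinal lt_jN)) => u uL.
apply: wlt_head; last exact: lt_letter.
by have := leq_trans uL Lw; rewrite /wlen ltnS.
Qed.

(** From D (b_(n) y) = b_(n) Dy - n b_(n-1) y: every letter passed by D costs a term with a lowered
    index. *)
Lemma cder_pmul L p y w : (L <= wlen w)%N -> mspan (len_le L) y ->
  mspan (below (wmul p w)) (cder (pmul iota p y) - pmul iota p (cder y)).
Proof.
move=> Lw yL; elim: p => [|[b n] p IH]; first by rewrite subrr; apply: lspan0.
rewrite [pmul _ _ y]/= [pmul _ _ (cder y)]/= cder_nprod -addrA -linearB /=.
apply: lspanD; last first.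
  by apply: (@mspan_left _ _ (b, n)) IH => u; apply: below_wcons.
(* The ordinal [n] must stay in the bound; only the index of the product is generalised for the case
   analysis. *)
suff: forall j, j = n :> nat -> mspan (below (wmul ((b, n) :: p) w))
  (nprod j (cder (iota b)) (pmul iota p y)) by exact.
case=> [|j] jn; first by rewrite nprod0_cder; apply: lspan0.
rewrite nprodS_cder; apply/lspanN/lspanMn.
rewrite wmul_wcons; apply: (@mspan_lower_index (size p + L)); first by rewrite -jn.
  by rewrite wlen_wmul leq_add2l.
exact: mspan_pmul_len.
Qed.

(** Here n is arbitrary; for n >= N this is not covered by [left_closed]. *)
Definition left_ok L y :=
  forall b n, mspan (len_le L.+1) (nprod n (iota b) y).

(* For n >= N the index is lowered by expanding (b_(n) b')_(m) y = 0. *)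
Lemma left_ok_nprod L (bn : B * 'I_N) y :
  mspan (len_le L) y -> left_ok L y -> left_ok L.+1 (nprod bn.2 (iota bn.1) y).
Proof.
move=> yL y_ok b n; suff: forall b' m,
  mspan (len_le L.+2) (nprod n (iota b) (nprod m (iota b') y)) by exact.
elim/ltn_ind: n => n IH b' m; have [lt_nN|le_Nn] := ltnP n N.
  by apply: (@mspan_left_len L.+1 (b, Ordinal lt_nN)); apply: y_ok.
rewrite nprodA_recl iota_local // nprod0l sub0r; apply/lspanN/lspan_sum => t _.
by apply/lspanZ/IH; have := ltn_ord t; lia.
Qed.

Lemma left_ok_pmul L p y :
  mspan (len_le L) y -> left_ok L y -> left_ok (size p + L) (pmul iota p y).
Proof.
move=> yL y_ok; elim: p => [|bn p IH]; first by [].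
apply: left_ok_nprod IH; exact: mspan_pmul_len.
Qed.

Lemma left_ok_iter_cder L i y :
  (forall x, mspan (len_le L.+1) x -> mspan (len_le L.+1) (cder x)) ->
  left_ok L y -> left_ok L (iter i cder y).
Proof.
move=> DL y_ok; elim: i => [|i IH] // b n.
by rewrite nprod_cder; apply: lspanD; [apply/DL/IH | apply/lspanMn/IH].
Qed.

Lemma left_okW L y : (forall x w, X x w -> left_ok (wlen w) x) ->
  mspan (len_le L) y -> left_ok L y.
Proof.
move=> X_ok yL b n; apply: lspan_image yL; first exact: linearP.
move=> x [w Xxw wL]; apply: (mspan_len _ (X_ok _ _ Xxw b n)).
by rewrite ltnS.
Qed.

Definition right_ok L x y := forall m, mspan (len_le L) (nprod m x y).

(** Associativity carries the product behind the multiplier, and the indices n - t in front stay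
    below N. *)
Lemma right_ok_pmul L p x y :
  right_ok L x y -> right_ok (size p + L) (pmul iota p x) y.
Proof.
move=> x_ok; elim: p => [|bn p IH] m //=.
rewrite nprodA; apply: lspan_sum => t _; apply: lspanZ.
have lt_N : (bn.2 - t < N)%N by apply: leq_ltn_trans (ltn_ord bn.2); apply: leq_subr.
exact: (@mspan_left_len _ (bn.1, Ordinal lt_N)).
Qed.

Lemma iter_cder_right_ok L y b i :
  left_ok L y -> right_ok L.+1 (iter i cder (iota b)) y.
Proof. by move=> y_ok m; rewrite nprod_iter_cder; apply/lspanZ/y_ok. Qed.

Lemma nw_right_ok L y u : left_ok L y -> right_ok (wlen u + L) (nw iota u) y.
Proof.
move=> y_ok; case: u => p [b i]; rewrite /wlen /= addSnnS.
exact/right_ok_pmul/iter_cder_right_ok.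
Qed.

Lemma nprod_left_below L bn x y w m : (L <= wlen w)%N -> right_ok L x y ->
  mspan (below (wcons bn w))
    (nprod m (nprod bn.2 (iota bn.1) x) y - nprod bn.2 (iota bn.1) (nprod m x y)).
Proof.
move=> Lw x_ok; rewrite nprodA big_ord_recl /= bin0 expr0 mulr1 scale1r subn0 addn0.
rewrite addrAC subrr add0r; apply: lspan_sum => t _; apply: lspanZ.
case: bn => b n /= in t *; apply: (@mspan_lower_index L) => //.
by rewrite /bump /= add1n; have := ltn_ord t; lia.
Qed.

Lemma nprod_pmul L p x y w m : (L <= wlen w)%N -> right_ok L x y ->
  mspan (below (wmul p w))
    (nprod m (pmul iota p x) y - pmul iota p (nprod m x y)).
Proof.
move=> Lw x_ok; elim: p => [|bn p IH] /=; first by rewrite subrr; apply: lspan0.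
rewrite -[X in mspan _ X](subrKA (nprod bn.2 (iota bn.1) (nprod m (pmul iota p x) y))).
apply: lspanD.
  rewrite wmul_wcons.
  apply: (@nprod_left_below (size p + L)); last exact: right_ok_pmul.
  by rewrite wlen_wmul leq_add2l.
rewrite -linearB; apply: mspan_left IH => u; apply: below_wcons.
Qed.

(** Induction along [p]: a shorter word, or a first difference within [p], is settled by length
    bounds alone, and if [p] is exhausted [x_below] takes over. The base [x] will be some D^i b for
    normal words, and a right operator applied to an element of S for normal S-words. *)
Lemma nprod_pmul_below p u0 w (m : 'I_N) x y v :
  right_ok (wlen u0 + wlen w) x y ->
  (forall v0, ind v0 = 0%N -> wlen v0 = wlen u0 -> wlt u0 v0 ->
     mspan (below (wmul (wmult v0 m) w)) (nprod m x y)) ->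
  ind v = 0%N -> wlt (wmul p u0) v ->
  mspan (below (wmul (wmult v m) w)) (nprod m (pmul iota p x) y).
Proof.
move=> x_ok x_below.
elim: p v => [|bn p IH] v v0 lt_v.
  have [lt_len|le_len] := ltnP (wlen u0) (wlen v).
    apply: (mspan_len_below _ (x_ok m)).
    by rewrite wlen_wmult ltn_add2r.
  apply: x_below => //.
  apply/eqP; rewrite eqn_leq le_len /=.
  by have := wle_len (ltW lt_v).
have [lt_len|le_len] := ltnP (wlen (wmul (bn :: p) u0)) (wlen v).
  apply: (mspan_len_below _ (right_ok_pmul _ x_ok m)).
  rewrite wlen_wmult addnA ltn_add2r.
  by move: lt_len; rewrite wlen_wmul.
case: v v0 lt_v le_len => [[|cn q] l] /= l0 lt_v le_len.
  by have := wle_len (ltW lt_v); rewrite wlen_wmul.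
have szE : size q = (size p + size u0.1)%N.
  apply/eqP; rewrite eqn_leq; move: le_len (wle_len (ltW lt_v)).
  by rewrite /wlen /= size_cat !ltnS => -> ->.
have lenE : (size p + (wlen u0 + wlen w) <= wlen (wmul (wmult (q, l) m) w))%N.
  by rewrite wlen_wmult addnA leq_add2r /wlen /= szE addnS.
move: lt_v; rewrite -[wmul _ _]/((bn :: (p ++ u0.1), u0.2) : T) wlt_cons ?size_cat //.
case/orP=> [lt_bc|/andP[/eqP <- lt_v]].
  rewrite nprodA; apply: lspan_sum => t _; apply: lspanZ.
  have lt_N : (bn.2 - t < N)%N by apply: leq_ltn_trans (ltn_ord bn.2); apply: leq_subr.
  have := right_ok_pmul p x_ok (m + t)%N.
  apply: (@mspan_left _ _ (bn.1, Ordinal lt_N)) => u uL.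
  apply: wlt_head; first by have := leq_trans uL lenE; rewrite /wlen ltnS.
  by apply: le_lt_trans lt_bc; apply: le_letter; apply: leq_subr.
rewrite -[X in mspan _ X](subrK (nprod bn.2 (iota bn.1) (nprod m (pmul iota p x) y))).
apply: lspanD; first exact: (nprod_left_below _ _ lenE (right_ok_pmul p x_ok)).
by apply: mspan_left (IH (q, l) l0 lt_v) => u; apply: below_wcons.
Qed.

Lemma nprod_nw_below u v w y (m : 'I_N) : X y w -> left_ok (wlen w) y ->
  ind v = 0%N -> wlt u v ->
  mspan (below (wmul (wmult v m) w)) (nprod m (nw iota u) y).
Proof.
case: u => p [b i] Xyw y_ok v0 lt_uv.
apply: (@nprod_pmul_below p ([::], (b, i)) w m) => //.
- exact: iter_cder_right_ok.
(* D-freeness of the larger word is used here: D^i b < c forces b < c, whatever i is. *)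
- case=> -[|//] [c j] j0 _; rewrite wlt_nil [j]j0 ltn0 andbF orbF => bc.
  rewrite nprod_iter_cder; apply: lspanZ.
  have lt_N : (m - i < N)%N by apply: leq_ltn_trans (ltn_ord m); apply: leq_subr.
  apply: (mspan_gen (X_left (b, Ordinal lt_N) Xyw)).
  by apply: wlt_head => //; rewrite ltxi_pair ltW //= leNgt bc.
- by rewrite /wmul cats0.
Qed.

Lemma nprod_nw v w y (m : 'I_N) : X y w -> left_ok (wlen w) y -> ind v = 0%N ->
  mspan (below (wmul (wmult v m) w))
    (nprod m (nw iota v) y - pmul iota (wmult v m) y).
Proof.
case: v => p [b i] Xyw y_ok /= i0.
rewrite /wmult -cats1 pmul_cat /nw /= [i]i0 /wmul -catA.
exact: (@nprod_pmul (wlen w).+1 p (iota b) y ((b, m) :: w.1, w.2) m).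
Qed.

End MarkedSpan.

(** * Leading words of derivatives and products of normal words *)

Section NormalWords.
Context {k : fieldType} {disp : Order.disp_t} {B : orderType disp} {N : nat}.
Context {C : assocConfAlgType k} (iota : B -> C).
Hypothesis iota_local : forall a b n, (N <= n)%N -> nprod n (iota a) (iota b) = 0.
Local Notation T := (word B N).
Implicit Types (u v w : T) (p : multiplier B N) (x y z : C) (b : B) (P Q : pred T).

Definition normal_word (x : C) (w : T) : Prop := x = nw iota w.
Local Notation NW := normal_word.

Lemma NW_left : left_closed iota NW. Proof. by move=> x w bn ->. Qed.

Lemma nw_pmul p w : nw iota (wmul p w) = pmul iota p (nw iota w).
Proof. exact: pmul_cat. Qed.

Lemma nw_cder u :
  mspan NW (below (wD u 1)) (cder (nw iota u) - nw iota (wD u 1)).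
Proof.
case: u => p [b i].
have := @cder_pmul _ _ _ _ _ iota NW NW_left 1 p (iter i cder (iota b))
  ([::], (b, i.+1)) isT.
rewrite /nw /wD /wmul /= addn1 cats0; apply.
by apply: (@mspan_gen _ _ _ _ _ NW _ _ ([::], (b, i))).
Qed.

Lemma mspan_cder_len L x :
  mspan NW (len_le L) x -> mspan NW (len_le L) (cder x).
Proof.
apply: lspan_image; first exact: linearP.
move=> y [u -> uL]; rewrite -[cder _](subrK (nw iota (wD u 1))); apply: lspanD.
  by apply: mspan_below_len (nw_cder u).
exact: (@mspan_gen _ _ _ _ _ NW _ _ (wD u 1)).
Qed.

Lemma nw_left_ok u : left_ok iota NW (wlen u) (nw iota u).
Proof.
case: u => p [b i]; rewrite -[wlen _]/(size p).+1 -addn1.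
have b_ok : left_ok iota NW 1 (iota b).
  move=> a n; have [lt_nN|le_Nn] := ltnP n N.
    exact: (@mspan_gen _ _ _ _ _ NW _ _ ([:: (a, Ordinal lt_nN)], (b, 0%N))).
  by rewrite iota_local //; apply: lspan0.
apply: (left_ok_pmul iota_local NW_left).
  exact: (@mspan_gen _ _ _ _ _ NW _ _ ([::], (b, i))).
by apply: left_ok_iter_cder => // x; apply: mspan_cder_len.
Qed.

Lemma NW_left_ok L x : mspan NW (len_le L) x -> left_ok iota NW L x.
Proof. by apply: left_okW => _ w ->; apply: nw_left_ok. Qed.

Lemma nw_nprod_len u v m :
  mspan NW (len_le (wlen u + wlen v)) (nprod m (nw iota u) (nw iota v)).
Proof. by apply: (nw_right_ok NW_left); apply: nw_left_ok. Qed.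

Lemma mspan_nprod_len L L' x y m :
  mspan NW (len_le L) x -> mspan NW (len_le L') y ->
  mspan NW (len_le (L + L')) (nprod m x y).
Proof.
move=> + yL; apply: (@lspan_image _ _ _ (nprod m ^~ y)); first exact: nprod_linear_l.
move=> _ [u -> uL]; apply: lspan_image yL; first exact: linearP.
by move=> _ [v -> vL]; apply: mspan_len (nw_nprod_len u v m); apply: leq_add.
Qed.

(** Monic with leading word [w], expressed by spans so as to make sense before the independence on
    which [bar] depends. *)
Definition lead x w : Prop := mspan NW (below w) (x - nw iota w).

Lemma lead_nw w : lead (nw iota w) w.
Proof. by rewrite /lead subrr; apply: lspan0. Qed.

Lemma mspan_cder_below w x :
  mspan NW (below w) x -> mspan NW (below (wD w 1)) (cder x).
Proof.
apply: lspan_image; first exact: linearP.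
move=> y [u -> uw]; rewrite -[cder _](subrK (nw iota (wD u 1))).
have lt_u : wlt (wD u 1) (wD w 1) by rewrite wlt_wD.
apply: lspanD; last by apply: (@mspan_gen _ _ _ _ _ NW _ _ (wD u 1)).
by apply: mspan_sub (nw_cder u) => v lt_v; apply: wlt_trans lt_u.
Qed.

Lemma lead_cder x w : lead x w -> lead (cder x) (wD w 1).
Proof.
move=> xw; rewrite /lead -(subrKA (cder (nw iota w))) -linearB.
by apply: lspanD; [apply: mspan_cder_below | apply: nw_cder].
Qed.

Lemma wD0 w : wD w 0 = w. Proof. by case: w => p [b i]; rewrite /wD /= addn0. Qed.

Lemma wDD w i j : wD (wD w i) j = wD w (i + j). 
Proof. by rewrite /wD /= addnA. Qed.

Lemma lead_iter_cder x w i : lead x w -> lead (iter i cder x) (wD w i).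
Proof.
move=> xw; elim: i => [|i IH]; first by rewrite wD0.
by rewrite -addn1 -wDD addn1; apply: lead_cder.
Qed.

Lemma lead_pmul p x w : lead x w -> lead (pmul iota p x) (wmul p w).
Proof.
move=> xw; rewrite /lead nw_pmul -linearB.
exact: (mspan_pmul NW_left).
Qed.

Lemma lead_nprod x v (m : 'I_N) c : lead x v -> ind v = 0%N ->
  lead (nprod m x (nw iota c)) (wmul (wmult v m) c).
Proof.
move=> xv v0; rewrite /lead -(subrKA (nprod m (nw iota v) (nw iota c))) -nprodBl.
apply: lspanD; last first.
  rewrite nw_pmul; apply: (nprod_nw NW_left) => //; exact: nw_left_ok.
apply: (@lspan_image _ _ _ (nprod m ^~ (nw iota c))) xv; first exact: nprod_linear_l.
move=> _ [u -> uv]; apply: (nprod_nw_below NW_left) => //; exact: nw_left_ok.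
Qed.

End NormalWords.

(** * Normal words form a basis of the free algebra *)

Section Subalgebra.
Context {k : fieldType} {C : assocConfAlgType k} (A : {pred C}).
Hypothesis A_linear : submod_closed A.
Hypothesis A_cder : forall x, x \in A -> cder x \in A.
Hypothesis A_nprod : forall n x y, x \in A -> y \in A -> nprod n x y \in A.

HB.instance Definition _ := GRing.isSubmodClosed.Build k C A A_linear.

Record subalg := Subalg { subalg_val :> C; _ : subalg_val \in A }.
HB.instance Definition _ := [isSub for subalg_val].
HB.instance Definition _ := [Choice of subalg by <:].
HB.instance Definition _ := [SubChoice_isSubLmodule of subalg by <:].

Implicit Types f g h : subalg.

Definition subalg_nprod n f g : subalg := Subalg (A_nprod n (valP f) (valP g)).
Definition subalg_cder f : subalg := Subalg (A_cder (valP f)).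

Lemma subalg_nprod_linear_l n g : linear (subalg_nprod n ^~ g).
Proof. by move=> c f h; apply: val_inj; exact: nprod_linear_l. Qed.

Lemma subalg_nprod_linear_r n f : linear (subalg_nprod n f).
Proof. by move=> c g h; apply: val_inj; exact: nprod_linear_r. Qed.

Lemma subalg_cder_linear : linear subalg_cder.
Proof. by move=> c g h; apply: val_inj; exact: cder_linear. Qed.

Lemma subalg_nprod_local f g :
  exists n0, forall n, (n0 <= n)%N -> subalg_nprod n f g = 0.
Proof.
have [n0 H] := nprod_local (val f) (val g); exists n0 => n /H E.
by apply: val_inj; rewrite /= E.
Qed.

Lemma subalg_cder_nprod n f g : subalg_cder (subalg_nprod n f g) =
  subalg_nprod n (subalg_cder f) g + subalg_nprod n f (subalg_cder g).
Proof. by apply: val_inj; rewrite /= cder_nprod. Qed.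

Lemma subalg_nprod0_cder f g : subalg_nprod 0 (subalg_cder f) g = 0.
Proof. by apply: val_inj; rewrite /= nprod0_cder. Qed.

Lemma subalg_nprodS_cder n f g :
  subalg_nprod n.+1 (subalg_cder f) g = - (subalg_nprod n f g *+ n.+1).
Proof. by apply: val_inj; rewrite raddfN raddfMn; exact: nprodS_cder. Qed.

HB.instance Definition _ := Lmodule_isConformal.Build k subalg
  subalg_nprod_linear_l subalg_nprod_linear_r subalg_cder_linear
  subalg_nprod_local subalg_cder_nprod subalg_nprod0_cder subalg_nprodS_cder.

Lemma subalg_nprodA n m f g h :
  nprod m (nprod n f g) h = \sum_(t < n.+1)
    ((-1) ^+ t * 'C(n, t)%:R : k) *: nprod (n - t)%N f (nprod (m + t)%N g h).
Proof.
by apply: val_inj; rewrite linear_sum /= nprodA; apply: eq_bigr.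
Qed.

HB.instance Definition _ := ConfAlg_isAssoc.Build k subalg subalg_nprodA.

(** The universal map into the subalgebra, followed by the inclusion, extends [iota], and so does
    the identity; by uniqueness they agree. *)
Lemma free_assoc_conf_ind (B : Type) (N : nat) (iota : B -> C) :
  free_assoc_conf N iota -> (forall b, iota b \in A) -> forall x, x \in A.
Proof.
move=> [iota_local free] iA x.
pose eps b : subalg := Subalg (iA b).
have eps_local a b n : (N <= n)%N -> nprod n (eps a) (eps b) = 0.
  by move=> /(iota_local a b n) E; apply: val_inj; rewrite linear0.
have [phi [[phi_l phi_D phi_n] phi_iota _]] := free subalg eps eps_local.
have [psi [_ _ uniq]] := free C iota iota_local.
have val_hom : conf_hom (val \o phi).
  split=> /=.
  - by move=> c y z; rewrite /= phi_l.
  - by move=> y; rewrite phi_D.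
  - by move=> n y z; rewrite phi_n.
have val_iota : (val \o phi) \o iota =1 iota.
  by move=> b /=; have /= -> := phi_iota b.
have E : val (phi x) = x.
  by rewrite -[LHS]/((val \o phi) x) (uniq _ val_hom val_iota) -(uniq id).
by rewrite -E; apply: valP.
Qed.

End Subalgebra.

Section Basis.
Context {k : fieldType} {disp : Order.disp_t} {B : orderType disp} {N : nat}.
Context {C : assocConfAlgType k} (iota : B -> C).
Hypothesis C_free : free_assoc_conf N iota.
Local Notation T := (word B N).
Local Notation NW := (normal_word (N := N) iota).
Implicit Types (u v w : T) (p : multiplier B N) (x y z : C) (b : B) (P Q : pred T).

Let iota_local : forall a b n, (N <= n)%N -> nprod n (iota a) (iota b) = 0.
Proof. by case: C_free. Qed.

Lemma nw_span x : exists L, mspan NW (len_le L) x.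
Proof.
pose A : {pred C} := fun x => `[< exists L, mspan NW (len_le L) x >].
suff: x \in A by move/asboolP.
apply: free_assoc_conf_ind C_free _ x.
- split; first by apply/asboolP; exists 0%N; apply: lspan0.
  move=> c y z /asboolP[L yL] /asboolP[L' zL]; apply/asboolP; exists (maxn L L').
  apply: lspanD; first apply: lspanZ.
    by apply: mspan_len yL; apply: leq_maxl.
  by apply: mspan_len zL; apply: leq_maxr.
- move=> y /asboolP[L yL]; apply/asboolP; exists L.
  exact: mspan_cder_len.
- move=> n y z /asboolP[L yL] /asboolP[L' zL]; apply/asboolP; exists (L + L')%N.
  exact: mspan_nprod_len.
move=> b; apply/asboolP; exists 1%N.
exact: (@mspan_gen _ _ _ _ _ NW _ _ ([::], (b, 0%N))).
Qed.

(** In the model, the coordinate of the largest word [u] of the support sees only the term of [u],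
    with factor 1. *)
Lemma nw_indep (c : {fsfun T -> k with 0}) :
  lincomb (nw iota) c = 0 -> forall u, c u = 0.
Proof.
move=> c0; have [C' [eps [cf [eps_local cf_l cf1 cf0]]]] :=
  triangular_model_exists k B N.
have [phi [[phi_l phi_D phi_n] phi_iota _]] := C_free.2 C' eps eps_local.
have phi_nw u : phi (nw iota u) = nw eps u.
  case: u => p [b i]; rewrite /nw /=; elim: p => [|bn p IH] /=.
    by elim: i => [|i IH]; rewrite /= ?phi_D ?IH //; apply: phi_iota.
  by rewrite phi_n IH; congr nprod; apply: phi_iota.
have [E v|/wle_max[u cu umax] _v] := eqVneq (finsupp c : seq T) [::].
  apply/fsfun_dflt/negP => vc; have : v \in (finsupp c : seq T) by [].
  by rewrite E.
exfalso.
have g_lin : linear (fun x => cf u (phi x) : k^o).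
  by move=> a x y; rewrite phi_l cf_l.
pose g : {linear C -> k^o} := HB.pack (fun x => cf u (phi x) : k^o)
  (GRing.isLinear.Build k C k^o *:%R _ g_lin).
have gZ a x : cf u (phi (a *: x)) = a * cf u (phi x).
  by rewrite -[LHS]/(g (a *: x)) linearZ.
have : g (lincomb (nw iota) c) = 0 by rewrite c0 linear0.
rewrite /lincomb linear_sum (bigD1_seq u cu (fset_uniq _)) /= big1_seq ?addr0; last first.
  move=> v /andP[vu vc]; rewrite gZ phi_nw cf0 ?mulr0 //.
  by have := umax v vc; rewrite wle_eqVlt (negPf vu).
rewrite gZ phi_nw cf1 mulr1 => cu0.
by move: cu; rewrite -[_ \in _]/(u \in finsupp c) mem_finsupp cu0 eqxx.
Qed.

Lemma nw_inj : injective (nw (N := N) iota).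
Proof.
move=> u v uv; have [c cE c_nw] := lincomb1 (nw iota) u.
have [d dE d_nw] := lincomb1 (nw iota) v.
have [f fE f_nw] := lincomb_linear (nw iota) (-1) c d.
have := nw_indep (c := f); rewrite f_nw c_nw d_nw uv scaleN1r addNr => /(_ erefl u).
rewrite fE cE dE eqxx mulr1; case: eqP => // _ /eqP.
by rewrite addr0 oppr_eq0 oner_eq0.
Qed.

Lemma coefs_spec x : x = lincomb (nw iota) (coefs (N := N) iota x).
Proof.
have [L /(lspan_mono (Y := fun y => exists2 u : T, setT u & y = nw iota u)) xL] :=
  nw_span x.
have [|c [_ xE]] := (lspan_lincombP (nw iota) setT x).1 (xL _).
  by move=> y [u -> _]; exists u.
by apply: (@xgetPex _ _ [set c | x = lincomb (nw iota) c]%classic); exists c.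
Qed.

Lemma coefs_lincomb c x : x = lincomb (nw iota) c -> coefs (N := N) iota x = c.
Proof.
move=> xc; apply/fsfunP => u.
have [f fE f0] := lincomb_linear (nw iota) (-1) c (coefs (N := N) iota x).
have := nw_indep (c := f); rewrite f0 -xc -coefs_spec scaleN1r addNr.
by move/(_ erefl u)/eqP; rewrite fE mulN1r addrC subr_eq0 => /eqP.
Qed.

Lemma coefs_linear a x y u :
  coefs iota (a *: x + y) u = a * coefs (N := N) iota x u + coefs iota y u.
Proof.
have [f fE f_xy] := lincomb_linear (nw iota) a
  (coefs (N := N) iota x) (coefs (N := N) iota y).
rewrite -fE; congr (fun_of_fsfun _ u); apply: coefs_lincomb.
by rewrite f_xy -!coefs_spec.
Qed.

Lemma coefs_nw u v : coefs iota (nw iota v) u = (u == v)%:R :> k.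
Proof.
have [f fE f_nw] := lincomb1 (nw iota) v.
by rewrite (coefs_lincomb (esym f_nw)) fE.
Qed.

Lemma coefs0 u : coefs iota 0 u = 0 :> k.
Proof.
by have := coefs_linear (-1) 0 0 u; rewrite scaler0 addr0 mulN1r addNr.
Qed.

Lemma coefs_mspan P x u : mspan NW P x -> coefs iota x u != 0 -> P u.
Proof.
elim=> [|a _ y [v -> Pv] _ IH]; first by rewrite coefs0 eqxx.
rewrite coefs_linear coefs_nw; case: (u =P v) => [->//|_].
by rewrite mulr0 add0r.
Qed.

Lemma mspan_coefs P x : (forall u, coefs (N := N) iota x u != 0 -> P u) -> mspan NW P x.
Proof.
move=> xP; rewrite [x]coefs_spec /lincomb big_seq; apply: lspan_sum => u.
rewrite mem_finsupp => /xP Pu.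
by apply/lspanZ; apply: (@mspan_gen _ _ _ _ _ NW _ _ u).
Qed.

Lemma leading_uniq x v w : leading iota x v -> leading iota x w -> v = w.
Proof.
move=> [xv v_max] [xw w_max]; apply/eqP; have := w_max _ xv.
by rewrite wle_eqVlt wltNge (v_max _ xw) orbF.
Qed.

Lemma bar_leading x w : bar iota x = Some w <-> leading iota x w.
Proof.
rewrite /bar; split=> [|xw].
  by case: xgetP => [o _ [v xv <-] [<-]|].
case: xgetP => [o _ [v xv <-]|/(_ (Some w))[]]; last by exists w.
by rewrite (leading_uniq xw xv).
Qed.

Lemma bar_None x : bar (N := N) iota x = None -> x = 0.
Proof.
move=> xN; rewrite [x]coefs_spec /lincomb.
have [E|/wle_max[u cu umax]] := eqVneq (finsupp (coefs (N := N) iota x) : seq T) [::].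
  by rewrite E big_nil.
suff: bar iota x = Some u by rewrite xN.
apply/bar_leading; split; first by rewrite /occurs -mem_finsupp.
by move=> v xv; apply: umax; rewrite -[_ \in _]/(v \in finsupp _) mem_finsupp.
Qed.

Lemma bar_mspan x w : bar iota x = Some w -> mspan NW (fun u => wle u w) x.
Proof. by move/bar_leading=> [_ max]; apply: mspan_coefs. Qed.

Lemma lead_bar x w : lead iota x w -> bar iota x = Some w.
Proof.
move=> xw; apply/bar_leading; have xE : x = 1 *: nw iota w + (x - nw iota w).
  by rewrite scale1r addrC subrK.
have low u : coefs iota (x - nw iota w) u != 0 -> wlt u w by exact: (coefs_mspan xw).
split=> [|u]; rewrite /occurs xE coefs_linear coefs_nw mul1r.
  have := low w; rewrite wlt_irr eqxx; case: eqP => [->|_ /(_ isT) //] _.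
  by rewrite addr0 oner_eq0.
have [->|uw] := eqVneq u w; first by rewrite wle_refl.
by rewrite add0r => /low/ltW.
Qed.

Lemma monic_lead x w : nw_monic N iota x -> bar iota x = Some w -> lead iota x w.
Proof.
move=> [v [xv xv1]] xw; move: xv xv1; rewrite xw => -[<-] xw1.
have [_ w_max] := (bar_leading x w).1 xw.
apply: mspan_coefs => u; rewrite addrC -scaleN1r coefs_linear coefs_nw.
case: (u =P w) => [->|/eqP uw]; first by rewrite xw1 mulr1 addNr eqxx.
by rewrite mulr0 add0r => /w_max; rewrite wle_eqVlt (negPf uw).
Qed.

End Basis.

(** * Normal S-words *)

Section SWords.
Context {k : fieldType} {disp : Order.disp_t} {B : orderType disp} {N : nat}.
Context {C : assocConfAlgType k} (iota : B -> C).
Hypothesis C_free : free_assoc_conf N iota.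
Local Notation T := (word B N).
Local Notation NW := (normal_word (N := N) iota).
Implicit Types (u v w : T) (p q : multiplier B N) (x y z s : C) (b : B) (P Q : pred T).

Let iota_local : forall a b n, (N <= n)%N -> nprod n (iota a) (iota b) = 0.
Proof. by case: C_free. Qed.

Lemma wmul_wmult v (m : 'I_N) w : wmul (wmult v m) w = wmul v.1 (wcons (v.2.1, m) w).
Proof. by rewrite /wmul /wmult /wcons cat_rcons. Qed.

(** Separates a comparison decided inside the prefixes, which survives a change of tails, from one
    decided behind equal prefixes. *)
Lemma wlt_split p q u v : size p = size q -> wlen u = wlen v ->
  wlt (wmul p u) (wmul q v) ->
  (forall u' v', (wlen u' <= wlen v')%N -> wlt (wmul p u') (wmul q v')) \/
  (p = q /\ wlt u v).
Proof.
move=> + uv; elim: p q => [|x p IH] [|y q] //.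
  by case: u v uv => [? ?] [? ?]; right.
move=> E; have pq : size p = size q by apply: succn_inj.
have sz : size (p ++ u.1) = size (q ++ v.1).
  by rewrite !size_cat pq; congr (_ + _)%N; apply: succn_inj.
rewrite -[wmul (x :: p) u]/((x :: (p ++ u.1), u.2) : T).
rewrite -[wmul (y :: q) v]/((y :: (q ++ v.1), v.2) : T).
rewrite (wlt_cons _ _ _ _ sz) => /orP[xy|/andP[/eqP<- /(IH _ pq)[H|[-> uv']]]].
- left=> u' v' uv'; apply: wlt_head => //.
  by rewrite !size_cat pq leq_add2l -ltnS.
- by left=> u' v' /H; rewrite -(wlt_wcons x).
- by right.
Qed.

Lemma wlt_wmult u v (j m : 'I_N) c d : ind v = 0%N -> wlen u = wlen v -> wlt u v ->
  (wlen c <= wlen d)%N -> wlt (wmul (wmult u j) c) (wmul (wmult v m) d).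
Proof.
case: u v => [p [b i]] [q [b' i']] /= i0 E lt_uv cd.
have pq : size p = size q by apply: succn_inj.
have := @wlt_split p q ([::], (b, i)) ([::], (b', i')) pq erefl.
rewrite !wmul_wmult /= {1 2}/wmul !cats0 => /(_ lt_uv)[]; first exact.
case=> ->; rewrite wlt_nil [i']i0 ltn0 andbF orbF => bb; rewrite wlt_wmul.
by apply: wlt_head => //; rewrite ltxi_pair ltW //= leNgt bb.
Qed.

(* The right operators x |-> D^i x and x |-> x_(m) [c]: a normal S-word is a
   multiplier applied to a right operator applied to an element of S. *)
Inductive rop := Rder of nat | Rmul of 'I_N & T.
Implicit Types (r t : rop).

Definition ract r x : C :=
  match r with Rder i => iter i cder x | Rmul m c => nprod m x (nw iota c) end.
Definition rword r w : T :=
  match r with Rder i => wD w i | Rmul m c => wmul (wmult w m) c end.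
(** The leading part of D after [r]: in D (x_(m) [c]) the term (Dx)_(m) [c] = - m x_(m-1) [c] has a
    lowered index, so D passes to c. *)
Definition rD r : rop :=
  match r with Rder i => Rder i.+1 | Rmul m c => Rmul m (wD c 1) end.

Lemma ract_linear r : linear (ract r).
Proof.
by case: r => [i|m c]; [exact: iter_cder_linear | exact: nprod_linear_l].
Qed.

Lemma lead_ract r x w : lead iota x w -> ind w = 0%N ->
  lead iota (ract r x) (rword r w).
Proof.
by case: r => [i|m c] xw w0; [exact: lead_iter_cder | exact: lead_nprod].
Qed.

Variable S : set C.
Hypothesis S_monic : forall s, S s -> nw_monic N iota s.
Hypothesis S_ind : forall s w, S s -> bar iota s = Some w -> ind w = 0%N.

(** Both kinds of normal S-words at once, each carrying its leading word, so that the estimates for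
    marked spans apply. *)
Inductive Sword : C -> T -> Prop :=
  SwordI p r s v of S s & bar iota s = Some v :
    Sword (pmul iota p (ract r s)) (wmul p (rword r v)).

Lemma S_bar s : S s -> exists v, bar iota s = Some v :> option T.
Proof. by case/S_monic=> v [sv _]; exists v. Qed.

Lemma S_lead s v : S s -> bar iota s = Some v -> lead iota s v.
Proof. by move=> /S_monic; apply: monic_lead. Qed.

Lemma S_len s v : S s -> bar iota s = Some v -> mspan NW (len_le (wlen v)) s.
Proof. by move=> Ss /(bar_mspan C_free); apply: mspan_sub => u /wle_len. Qed.

Lemma Sword_lead x w : Sword x w -> lead iota x w.
Proof.
by case=> p r s v Ss sv; apply/lead_pmul/lead_ract; [apply: S_lead | apply: S_ind sv].
Qed.

Lemma Sword_bar x w : Sword x w -> bar iota x = Some w.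
Proof. by move/Sword_lead; apply: lead_bar. Qed.

Lemma Sword_left : left_closed iota Sword.
Proof. by move=> _ _ bn [p r s v Ss sv]; apply: (SwordI (bn :: p) r Ss sv). Qed.

Lemma Sword_ract r s v : S s -> bar iota s = Some v -> Sword (ract r s) (rword r v).
Proof.
move=> Ss sv; have := SwordI [::] r Ss sv.
by rewrite /wmul; case: (rword r v).
Qed.

Lemma Sword_normal x w : Sword x w -> normal_Sword (N := N) iota S x.
Proof.
case=> p [i|m c] s v Ss sv; first exact: Sword_second.
exact: (Sword_first p m c Ss sv (S_ind Ss sv)).
Qed.

Lemma normal_Sword_mark x : normal_Sword (N := N) iota S x -> exists w, Sword x w.
Proof.
case=> [p s v m c Ss sv _|p i s Ss].
  by eexists; apply: (SwordI p (Rmul m c) Ss sv).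
by have [v sv] := S_bar Ss; eexists; apply: (SwordI p (Rder i) Ss sv).
Qed.

Lemma nprod_S_len s v (j : nat) L z : S s -> bar iota s = Some v -> (j < N)%N ->
  mspan NW (len_le L) z -> mspan Sword (len_le (wlen v + L)) (nprod j s z).
Proof.
move=> Ss sv jN; apply: lspan_image; first exact: linearP.
move=> _ [c -> cL]; apply: (mspan_gen (Sword_ract (Rmul (Ordinal jN) c) Ss sv)).
by rewrite /len_le wlen_wmult leq_add2l.
Qed.

Lemma nprod_S_lower s v (j : nat) (m : 'I_N) L z c :
  S s -> bar iota s = Some v -> (j < m)%N -> (L <= wlen c)%N ->
  mspan NW (len_le L) z -> mspan Sword (below (wmul (wmult v m) c)) (nprod j s z).
Proof.
move=> Ss sv jm Lc; apply: lspan_image; first exact: linearP.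
have jN := ltn_trans jm (ltn_ord m).
move=> _ [d -> dL]; apply: (mspan_gen (Sword_ract (Rmul (Ordinal jN) d) Ss sv)).
rewrite /below /= !wmul_wmult wlt_wmul; apply: wlt_head; last exact: lt_letter.
by rewrite -ltnS; apply: leq_trans Lc.
Qed.

Lemma nprod_S_below s v (m : 'I_N) z c : S s -> bar iota s = Some v ->
  mspan NW (below c) z -> mspan Sword (below (wmul (wmult v m) c)) (nprod m s z).
Proof.
move=> Ss sv; apply: lspan_image; first exact: linearP.
move=> _ [d -> dc]; apply: (mspan_gen (Sword_ract (Rmul m d) Ss sv)).
by rewrite /below /= wlt_wmul.
Qed.

Lemma ract_len r s v : S s -> bar iota s = Some v ->
  mspan Sword (len_le (wlen (rword r v))) (ract r s).
Proof. by move=> Ss sv; apply: (mspan_gen (Sword_ract r Ss sv)); apply: leqnn. Qed.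

Lemma rword_rD r v : rword (rD r) v = wD (rword r v) 1.
Proof. by case: r => [i|m c] //=; rewrite wDD addn1. Qed.

Lemma cder_ract r s v : S s -> bar iota s = Some v ->
  mspan Sword (below (rword (rD r) v)) (cder (ract r s) - ract (rD r) s).
Proof.
move=> Ss sv; case: r => [i|m c] /=; first by rewrite subrr; apply: lspan0.
rewrite cder_nprod -addrA -linearB; apply: lspanD.
  suff: forall j, j = m :> nat ->
    mspan Sword (below (wmul (wmult v m) (wD c 1))) (nprod j (cder s) (nw iota c)).
    exact.
  case=> [|j] jm; first by rewrite nprod0_cder; apply: lspan0.
  rewrite nprodS_cder; apply/lspanN/lspanMn.
  apply: (@nprod_S_lower _ _ _ _ (wlen c)) => //; first by rewrite -jm.
  by apply: (@mspan_gen _ _ _ _ _ NW _ _ c) => //; apply: leqnn.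
by apply: nprod_S_below => //; apply: nw_cder.
Qed.

Lemma cder_Sword p r s v : S s -> bar iota s = Some v ->
  mspan Sword (below (wD (wmul p (rword r v)) 1))
    (cder (pmul iota p (ract r s)) - pmul iota p (ract (rD r) s)).
Proof.
move=> Ss sv; rewrite -(subrKA (pmul iota p (cder (ract r s)))) -linearB /=.
rewrite wmul_wD; apply: lspanD.
  by apply: (cder_pmul Sword_left _ _ (ract_len r Ss sv)); rewrite wlen_wD.
rewrite -rword_rD; apply: (mspan_pmul Sword_left); exact: cder_ract.
Qed.

Lemma mspan_Sword_cder w x :
  mspan Sword (below w) x -> mspan Sword (below (wD w 1)) (cder x).
Proof.
apply: lspan_image; first exact: linearP.
move=> _ [_ [p r s v Ss sv] lt_w].
rewrite -[cder _](subrK (pmul iota p (ract (rD r) s))).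
have lt_w1 : wlt (wD (wmul p (rword r v)) 1) (wD w 1) by rewrite wlt_wD.
apply: lspanD.
  by apply: mspan_sub (cder_Sword p r Ss sv) => u /wlt_trans; apply.
by apply: (mspan_gen (SwordI p (rD r) Ss sv)); rewrite rword_rD.
Qed.

Lemma mspan_Sword_cder_len L x :
  mspan Sword (len_le L) x -> mspan Sword (len_le L) (cder x).
Proof.
apply: lspan_image; first exact: linearP.
move=> _ [_ [p r s v Ss sv] wL].
rewrite -[cder _](subrK (pmul iota p (ract (rD r) s))); apply: lspanD.
  by apply: mspan_below_len (cder_Sword p r Ss sv).
by apply: (mspan_gen (SwordI p (rD r) Ss sv)); rewrite rword_rD.
Qed.

(** These two bounds are all that is asked of the compositions of multiplication: for every index, a
    product of an element of S with a generator stays in the span of normal S-words of the expected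
    length. *)
Hypothesis S_right : forall s v b m, S s -> bar iota s = Some v ->
  mspan Sword (len_le (wlen v).+1) (nprod m s (iota b)).
Hypothesis S_left : forall s v b n, S s -> bar iota s = Some v ->
  mspan Sword (len_le (wlen v).+1) (nprod n (iota b) s).

Lemma right_step L l x z m :
  (forall s v m z, S s -> bar iota s = Some v -> mspan NW (len_le l) z ->
     mspan Sword (len_le (wlen v + l)) (nprod m s z)) ->
  mspan Sword (len_le L) x -> mspan NW (len_le l) z ->
  mspan Sword (len_le (L + l)) (nprod m x z).
Proof.
move=> S_l + zl; apply: (@lspan_image _ _ _ (nprod m ^~ z)); first exact: nprod_linear_l.
move=> _ [_ [p r s v Ss sv] wL].
apply: (@mspan_len _ _ _ _ _ _ (size p + (wlen (rword r v) + l))).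
  by rewrite addnA leq_add2r -wlen_wmul; exact: wL.
apply: (right_ok_pmul Sword_left) => {}m; case: r {wL} => [i|m0 c] /=.
  by rewrite nprod_iter_cder; apply/lspanZ; exact: (S_l s v _ _ Ss sv zl).
rewrite nprodA; apply: lspan_sum => t _; apply: lspanZ.
rewrite wlen_wmult -addnA; apply: nprod_S_len => //.
  by apply: leq_ltn_trans (ltn_ord m0); apply: leq_subr.
apply: mspan_nprod_len => //.
by apply: (@mspan_gen _ _ _ _ _ NW _ _ c) => //; apply: leqnn.
Qed.

(** Induction on the length of z, then on m: s_(m) (b_(n) z') equals (s_(m) b)_(n) z', whose right
    factor is shorter, up to terms s_(m-t) (b_(n+t) z') with t > 0. *)
Lemma S_right_len l s v m z : S s -> bar iota s = Some v -> mspan NW (len_le l) z ->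
  mspan Sword (len_le (wlen v + l)) (nprod m s z).
Proof.
elim: l s v m z => [|l IHl] s v m z Ss sv.
  by elim=> [|c y x [w _]] //; rewrite linear0; apply: lspan0.
elim/ltn_ind: m z => m IHm z; apply: lspan_image; first exact: linearP.
move=> _ [[[|[b n] p] [d i]] -> cl].
  elim: i m {IHm cl} => [|i IHi] m.
    apply: (mspan_len _ (S_right d m Ss sv)).
    by rewrite addnS ltnS leq_addr.
  rewrite nprod_cder; apply: lspanD; first exact: mspan_Sword_cder_len.
  exact: lspanMn.
rewrite -[nw _ _]/(nprod n (iota b) (nw iota (p, (d, i)))) nprodA_recl.
apply: lspanB.
  rewrite -addn1 addnA addnAC; apply: right_step.
  - by move=> s' v' m' z' Ss' sv'; apply: IHl.
  - by rewrite addn1; apply: S_right.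
  - exact: (@mspan_gen _ _ _ _ _ NW _ _ (p, (d, i))).
apply: lspan_sum => t _; apply/lspanZ/IHm; first by have := ltn_ord t; lia.
apply: (mspan_len _ (nw_left_ok iota_local (p, (d, i)) b _)).
exact: cl.
Qed.

Lemma Sword_right_len L l x z m :
  mspan Sword (len_le L) x -> mspan NW (len_le l) z ->
  mspan Sword (len_le (L + l)) (nprod m x z).
Proof. by apply: right_step => *; apply: S_right_len. Qed.

Lemma Sword_left_ok x w : Sword x w -> left_ok iota Sword (wlen w) x.
Proof.
case=> p r s v Ss sv; rewrite wlen_wmul.
apply: (left_ok_pmul iota_local Sword_left); first exact: ract_len.
case: r => [i|m c] /=.
  apply: left_ok_iter_cder; first exact: mspan_Sword_cder_len.
  by move=> b n; exact: (S_left b n Ss sv).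
move=> b n; rewrite wlen_wmult.
(* The expansion raises the inner index beyond N, so [m] cannot remain an ordinal. *)
suff: forall m : nat, mspan Sword (len_le (wlen v + wlen c).+1)
  (nprod n (iota b) (nprod m s (nw iota c))) by exact.
elim/ltn_ind: n => n IH {}m; rewrite nprodA_recl; apply: lspanB.
  rewrite -addSn; apply: Sword_right_len; first exact: S_left.
  by apply: (@mspan_gen _ _ _ _ _ NW _ _ c) => //; apply: leqnn.
by apply: lspan_sum => t _; apply/lspanZ/IH; have := ltn_ord t; lia.
Qed.

Lemma mspan_Sword_left_ok L x : mspan Sword (len_le L) x -> left_ok iota Sword L x.
Proof. by apply: left_okW => y w; apply: Sword_left_ok. Qed.

Lemma word_split n w : (n < size w.1)%N ->
  exists q bn c, size q = n /\ w = wmul q (wcons bn c).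
Proof.
case: w => l r /= lt_n; exists (take n l).
case E : (drop n l) => [|bn c].
  by have := size_drop n l; rewrite E => /esym/eqP; rewrite subn_eq0 leqNgt lt_n.
exists bn, (c, r); rewrite size_takel 1?ltnW //; split=> //.
by rewrite /wmul /wcons /= -E cat_take_drop.
Qed.

Lemma nw_len (c : T) : mspan NW (len_le (wlen c)) (nw iota c).
Proof. by apply: (@mspan_gen _ _ _ _ _ NW _ _ c) => //; apply: leqnn. Qed.

(** In the main case the S-word is s_(m0) [c0], and [v] is cut at the length of the leading word [u]
    of s. A difference inside [u] or at the index m0 makes every term of the associativity expansion
    smaller. Otherwise c0 is below the rest [d] of [v]: the t = 0 term falls under the order on
    normal words, and the terms with t > 0 have a lowered index. *)
Lemma nprod_Sword_below x v (m : 'I_N) (c : T) : ind v = 0%N ->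
  mspan Sword (below v) x ->
  mspan Sword (below (wmul (wmult v m) c)) (nprod m x (nw iota c)).
Proof.
move=> v0; apply: (@lspan_image _ _ _ (nprod m ^~ (nw iota c))).
  exact: nprod_linear_l.
move=> _ [_ [p r s u Ss su] lt_v].
apply: (nprod_pmul_below Sword_left) v0 lt_v => [j|{}v v0].
  exact: (Sword_right_len j (ract_len r Ss su) (nw_len c)).
case: r => [i|m0 c0] /= len_v lt_v.
  rewrite nprod_iter_cder; apply: lspanZ.
  have lt_N : (m - i < N)%N by apply: leq_ltn_trans (ltn_ord m); apply: leq_subr.
  apply: (mspan_gen (Sword_ract (Rmul (Ordinal lt_N) c) Ss su)).
  exact: (@wlt_wmult (wD u i) v).
have [|q [[b j] [d [sz vE]]]] := @word_split (size u.1) v.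
  suff: (wlen u < wlen v)%N by [].
  by rewrite len_v wlen_wmult -addn1 leq_add2l.
subst v; have len_d : wlen d = wlen c0.
  move: len_v; rewrite wlen_wmult wlen_wmul wlen_wcons sz {2}/wlen.
  by rewrite addSnnS => /addnI/succn_inj.
rewrite wmul_wmult in lt_v.
have prodE : wmul (wmult (wmul q (wcons (b, j) d)) m) c =
    wmul q (wcons (b, j) (wmul (wmult d m) c)).
  by rewrite /wmul /wmult /wcons /= rcons_cat /= -catA.
have len_prod (t : nat) : mspan NW (len_le (wlen c0 + wlen c))
    (nprod t (nw iota c0) (nw iota c)) by apply: nw_nprod_len.
have lt_tN (t : nat) : (m0 - t < N)%N.
  by apply: leq_ltn_trans (ltn_ord m0); apply: leq_subr.
rewrite prodE nprodA.
have [|H|[uq]] := wlt_split (esym sz) _ lt_v.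
- by rewrite !wlen_wcons len_d.
- apply: lspan_sum => t _; apply: lspanZ.
  apply: lspan_image (len_prod (m + t)%N); first exact: linearP.
  move=> _ [e -> eL]; apply: (mspan_gen (Sword_ract (Rmul (Ordinal (lt_tN t)) e) Ss su)).
  rewrite /below /= wmul_wmult; apply: H.
  by rewrite !wlen_wcons wlen_wmult len_d ltnS.
rewrite -uq => lt_d.
have len_dc : (wlen c0 + wlen c <= wlen (wmul (wmult d m) c))%N.
  by rewrite wlen_wmult len_d.
have sz_d : size c0.1 = size d.1 by apply: succn_inj.
have lower (t : nat) : (((u.2.1, Ordinal (lt_tN t)) : B *l 'I_N) < (b, j))%O ->
    mspan Sword (below (wmul u.1 (wcons (b, j) (wmul (wmult d m) c))))
      (nprod (m0 - t) s (nprod (m + t) (nw iota c0) (nw iota c))).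
  move=> lt_b; apply: lspan_image (len_prod (m + t)%N); first exact: linearP.
  move=> _ [e -> eL]; apply: (mspan_gen (Sword_ract (Rmul (Ordinal (lt_tN t)) e) Ss su)).
  rewrite /below /= wmul_wmult wlt_wmul; apply: wlt_head => //.
  by have := leq_trans eL len_dc; rewrite ltnS.
move: lt_d; rewrite /wcons wlt_cons //.
case/orP=> [lt_b|/andP[/eqP[ub E] lt_d]].
  apply: lspan_sum => t _; apply/lspanZ/lower; apply: le_lt_trans lt_b.
  by apply: (@le_letter _ _ _ (u.2.1, m0)); apply: leq_subr.
rewrite big_ord_recl /= bin0 expr0 mulr1 scale1r subn0 addn0; apply: lspanD.
  rewrite -[X in below X]/(wmul u.1 (wcons (b, j) (wmul (wmult d m) c))).
  rewrite -ub -E -wmul_wmult.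
  apply: nprod_S_below => //.
  apply: (@nprod_nw_below _ _ _ _ _ iota NW (@NW_left _ _ _ _ _ iota) c0 d c) => //.
    exact: nw_left_ok.
apply: lspan_sum => t _; apply/lspanZ/lower; rewrite -ub -E; apply: lt_letter.
by rewrite /= /bump /= add1n; have := ltn_ord t; lia.
Qed.

Definition rfree r : Prop :=
  match r with Rder i => i = 0%N | Rmul m c => ind c = 0%N end.
(** First [t], then [r], up to smaller terms. For [t] = [Rder i] this is right only at i = 0, which
    [rfree] ensures. *)
Definition rcomp t r : rop :=
  match t with Rder _ => r | Rmul m c => Rmul m (rword r c) end.

Lemma rword_comp t r v : rfree t -> rword (rcomp t r) v = rword r (rword t v).
Proof.
case: t => [_ ->|m c _] /=; first by rewrite wD0.
case: r => [i|n d] //=.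
by rewrite /wmul /wmult /= rcons_cat -catA.
Qed.

Lemma rword_wmul r p w : rword r (wmul p w) = wmul p (rword r w).
Proof. by case: r => [i|m c] //=; rewrite /wmul /wmult /= rcons_cat -catA. Qed.

Lemma ind_rword r v : rfree r -> ind v = 0%N -> ind (rword r v) = 0%N.
Proof. by case: r => [i ->|m c] //=; rewrite /ind /= addn0. Qed.

Lemma ract_below r x w : ind w = 0%N ->
  mspan Sword (below w) x -> mspan Sword (below (rword r w)) (ract r x).
Proof.
case: r => [i|m c] w0 xw /=; last exact: nprod_Sword_below.
elim: i => [|i IH]; first by rewrite wD0.
by rewrite -addn1 -wDD addn1; apply: mspan_Sword_cder.
Qed.

(** Moving [r] inside creates terms with a lowered index and replaces a product [d]_(m) [c] by its
    leading normal word; both changes are by smaller S-words. *)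
Lemma ract_Sword p t r s v : S s -> bar iota s = Some v -> rfree t ->
  mspan Sword (below (rword r (wmul p (rword t v))))
    (ract r (pmul iota p (ract t s)) - pmul iota p (ract (rcomp t r) s)).
Proof.
move=> Ss sv t0; case: r => [i|m c].
  have rcE i' : rcomp t (Rder i'.+1) = rD (rcomp t (Rder i')).
    by case: t {t0} => [j|n d] //=; rewrite wDD addn1.
  elim: i => [|i IH].
    have -> : rcomp t (Rder 0) = t.
      by move: t0; case: (t) => [j ->|n d] //=; rewrite wD0.
    by rewrite subrr; apply: lspan0.
  rewrite rcE [ract _ _]/= -/(ract (Rder i) _).
  rewrite -(subrKA (cder (pmul iota p (ract (rcomp t (Rder i)) s)))) -linearB.
  apply: lspanD.
    by rewrite /= -addn1 -wDD; apply: mspan_Sword_cder.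
  have := cder_Sword p (rcomp t (Rder i)) Ss sv.
  by rewrite rword_comp // -rword_wmul /= wDD addn1.
rewrite -(subrKA (pmul iota p (ract (Rmul m c) (ract t s)))).
rewrite rword_wmul; apply: lspanD.
  apply: (nprod_pmul Sword_left) => [|j].
    rewrite /= wlen_wmult; exact: leqnn.
  exact: (Sword_right_len j (ract_len t Ss sv) (nw_len c)).
rewrite -linearB; apply: (mspan_pmul Sword_left).
case: t t0 => [_ ->|n d d0] /=; first by rewrite subrr; apply: lspan0.
rewrite nprodA big_ord_recl /= bin0 expr0 mulr1 scale1r subn0 addn0 addrAC -linearB.
have dE : wmul (wmult (wmul (wmult v n) d) m) c = wmul (wmult v n) (wmul (wmult d m) c).
  by rewrite /wmul /wmult /= rcons_cat -catA.
rewrite dE; apply: lspanD.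
  apply: nprod_S_below => //; apply: lead_nprod d0 => //; exact: lead_nw.
apply: lspan_sum => t _; apply: lspanZ.
apply: (@nprod_S_lower _ _ _ _ (wlen d + wlen c)) => //.
- by rewrite /bump /= add1n; have := ltn_ord t; lia.
- by rewrite wlen_wmult.
exact: nw_nprod_len.
Qed.

End SWords.

(** * The composition-diamond lemma *)

Section Confluence.
Context {k : fieldType} {disp : Order.disp_t} {B : orderType disp} {N : nat}.
Context {C : assocConfAlgType k} (iota : B -> C).
Hypothesis C_free : free_assoc_conf N iota.
Local Notation T := (word B N).
Local Notation NW := (normal_word (N := N) iota).
Implicit Types (u v w c : T) (p q : multiplier B N) (x y z s h : C) (b : B)
  (P Q : pred T) (r t : rop (B := B) (N := N)).

Variable S : set C.
Hypothesis S_monic : forall s, S s -> nw_monic N iota s.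
Hypothesis S_ind : forall s w, S s -> bar iota s = Some w -> ind w = 0%N.
Local Notation Sw := (Sword (N := N) iota S).

Let iota_local : forall a b n, (N <= n)%N -> nprod n (iota a) (iota b) = 0.
Proof. by case: C_free. Qed.

Definition down_closed P := forall u v, wle u v -> P v -> P u.

Definition upto w : pred T := fun u => wle u w.

Lemma below_down w : down_closed (below w).
Proof. by move=> u v uv vw; exact: (wle_lt_trans uv vw). Qed.

Lemma upto_down w : down_closed (upto w).
Proof. by move=> u v uv vw; exact: (wle_trans uv vw). Qed.

Lemma len_le_down L : down_closed (len_le (B := B) (N := N) L).
Proof. by move=> u v /wle_len uv vL; exact: (leq_trans uv vL). Qed.

(** Triviality bounds the S-words by [bar h], so a downward closed condition on the words of [h]
    passes to them. It is applied to length bounds and to [below w]. *)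
Lemma trivial_mspan P h : trivial_mod (N := N) iota S h -> down_closed P ->
  mspan NW P h -> mspan Sw P h.
Proof.
case=> c [c_S hE] P_down hP.
apply: lspan_mono ((lspan_lincombP id (fun x => x \in finsupp c) h).2 _).
  move=> _ [x xc ->]; have [/(normal_Sword_mark S_monic)[w xw]] := c_S x xc.
  rewrite (Sword_bar C_free S_monic S_ind xw).
  case hu : (bar iota h) => [u|//] wu; exists w => //.
  apply: P_down wu _; have [hu' _] := (bar_leading iota h u).1 hu.
  exact: (coefs_mspan C_free hP).
by exists c.
Qed.

(** Associativity only raises the inner index, so the last letter meets [b] at an index >= N. This
    is why right multiplication with n >= N is a composition only for elements that are not
    D-free. *)
Lemma nprod_D_free x (m : nat) b : D_free (N := N) iota x -> (N <= m)%N ->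
  nprod m x (iota b) = 0.
Proof.
move=> x_free Nm; have : mspan NW (fun u => ind u == 0%N) x.
  by apply: (mspan_coefs C_free) => u xu; apply/eqP/x_free.
elim=> [|a _ y [[p [d i]] -> /eqP i0] _ IH]; first exact: nprod0l.
have {}i0 : i = 0%N := i0.
rewrite nprod_linear_l IH addr0 /nw i0 /=.
suff -> : forall j, (N <= j)%N -> nprod j (pmul iota p (iota d)) (iota b) = 0.
  by rewrite scaler0.
  exact: Nm.
elim: p => [|[e n] p IHp] j Nj /=; first exact: iota_local.
rewrite nprodA big1 // => t _; rewrite IHp ?linear0 ?scaler0 //.
by rewrite (leq_trans Nj) ?leq_addr.
Qed.

Section Basis.
Hypothesis S_GS : GS_basis N iota S.

Lemma GS_S_right s v b m : S s -> bar iota s = Some v ->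
  mspan Sw (len_le (wlen v).+1) (nprod m s (iota b)).
Proof.
move=> Ss sv; have [lt_mN|le_Nm] := ltnP m N.
  apply: (mspan_gen (Sword_ract (Rmul (Ordinal lt_mN) ([::], (b, 0%N))) Ss sv)).
  by rewrite /len_le wlen_wmult addn1.
have [s_free|s_nfree] := pselect (D_free (N := N) iota s).
  by rewrite nprod_D_free //; apply: lspan0.
apply: trivial_mspan; first by apply: (S_GS Ss Ss); apply: comp_right_mult; right.
  exact: len_le_down.
rewrite -addn1; apply: (mspan_nprod_len iota_local); first exact: S_len sv.
exact: (@mspan_gen _ _ _ _ _ NW _ _ ([::], (b, 0%N))).
Qed.

Lemma GS_S_left s v b n : S s -> bar iota s = Some v ->
  mspan Sw (len_le (wlen v).+1) (nprod n (iota b) s).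
Proof.
move=> Ss sv; have [lt_nN|le_Nn] := ltnP n N.
  by apply: (mspan_gen (SwordI [:: (b, Ordinal lt_nN)] (Rder 0) Ss sv)); exact: leqnn.
apply: trivial_mspan; first by apply: (S_GS Ss Ss); apply: comp_left_mult.
  exact: len_le_down.
exact: (NW_left_ok iota_local (S_len C_free Ss sv)).
Qed.

Lemma Sword_congW x y w : trivial_mod (N := N) iota S (x - y) ->
  Sw x w -> Sw y w -> mspan Sw (below w) (x - y).
Proof.
move=> xy_triv xw yw; apply: trivial_mspan xy_triv (@below_down w) _.
rewrite -(subrKA (nw iota w)); apply: lspanD; last rewrite -opprB; last apply: lspanN.
  exact: (Sword_lead C_free S_monic S_ind xw).
exact: (Sword_lead C_free S_monic S_ind yw).
Qed.

(* Reduces the coincidences of leading words to the compositions. *)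
Lemma Sword_cong_ract p1 t1 s1 v1 p2 t2 s2 v2 r :
  S s1 -> bar iota s1 = Some v1 -> S s2 -> bar iota s2 = Some v2 ->
  rfree t1 -> rfree t2 ->
  wmul p1 (rword t1 v1) = wmul p2 (rword t2 v2) ->
  trivial_mod (N := N) iota S
    (pmul iota p1 (ract iota t1 s1) - pmul iota p2 (ract iota t2 s2)) ->
  mspan Sw (below (rword r (wmul p1 (rword t1 v1))))
    (pmul iota p1 (ract iota (rcomp t1 r) s1) -
     pmul iota p2 (ract iota (rcomp t2 r) s2)).
Proof.
move=> Ss1 sv1 Ss2 sv2 t1_free t2_free wE triv.
have Sr := GS_S_right; have Sl := GS_S_left.
set x := pmul iota p1 (ract iota t1 s1) in triv *.
set y := pmul iota p2 (ract iota t2 s2) in triv *.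
(* The comparison passes through [r] applied to [x] and to [y]; in the middle [r] acts on the
   trivial composition [x - y], which is below a D-free word. *)
rewrite -(subrKA (ract iota r x)) -[X in _ + X](subrKA (ract iota r y)).
apply: lspanD; last apply: lspanD.
- rewrite -opprB; apply: lspanN.
  exact: (ract_Sword C_free Sr p1 r Ss1 sv1 t1_free).
- have -> : ract iota r x - ract iota r y = ract iota r (x - y).
    have := ract_linear iota r (-1) y x; rewrite !scaleN1r addrC => <-.
    by rewrite addrC.
  have yw : Sw y (wmul p1 (rword t1 v1)) by rewrite wE; apply: SwordI.
  apply: (ract_below C_free Sr) (Sword_congW triv _ yw); last exact: SwordI.
  rewrite -[ind _]/(ind (rword t1 v1)); apply: ind_rword => //.
  exact: S_ind sv1.
rewrite wE; exact: (ract_Sword C_free Sr p2 r Ss2 sv2 t2_free).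
Qed.

Lemma cong_right_inclusion p s1 v1 s2 v2 r :
  S s1 -> bar iota s1 = Some v1 -> S s2 -> bar iota s2 = Some v2 ->
  v1 = wmul p v2 ->
  mspan Sw (below (rword r v1)) (ract iota r s1 - pmul iota p (ract iota r s2)).
Proof.
move=> Ss1 sv1 Ss2 sv2 vE.
have := @Sword_cong_ract [::] (Rder 0) s1 v1 p (Rder 0) s2 v2 r Ss1 sv1 Ss2 sv2.
rewrite /= !wD0 -vE; have -> : wmul [::] v1 = v1 by case: (v1).
apply=> //; apply: (S_GS Ss1 Ss2).
by apply: (comp_right_inclusion (i := 0) sv1 sv2); rewrite wD0.
Qed.

Lemma cong_inclusion p s1 v1 s2 v2 m c r :
  S s1 -> bar iota s1 = Some v1 -> S s2 -> bar iota s2 = Some v2 ->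
  v1 = wmul p (wmul (wmult v2 m) c) -> ind c = 0%N ->
  mspan Sw (below (rword r v1))
    (ract iota r s1 - pmul iota p (ract iota (Rmul m (rword r c)) s2)).
Proof.
move=> Ss1 sv1 Ss2 sv2 vE c0.
have := @Sword_cong_ract [::] (Rder 0) s1 v1 p (Rmul m c) s2 v2 r Ss1 sv1 Ss2 sv2.
rewrite [rcomp (Rder 0) r]/= [rword (Rder 0) v1]/= wD0.
have -> : wmul [::] v1 = v1 by case: (v1).
apply=> //; apply: (S_GS Ss1 Ss2).
exact: (comp_inclusion sv1 sv2 (S_ind Ss2 sv2) vE).
Qed.

Lemma cong_intersection p s1 v1 s2 v2 m c r :
  S s1 -> bar iota s1 = Some v1 -> S s2 -> bar iota s2 = Some v2 ->
  wmul (wmult v1 m) c = wmul p v2 -> ind c = 0%N -> (wlen c < wlen v2)%N ->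
  mspan Sw (below (rword r (wmul p v2)))
    (ract iota (Rmul m (rword r c)) s1 - pmul iota p (ract iota r s2)).
Proof.
move=> Ss1 sv1 Ss2 sv2 wE c0 lt_c; have [p0|pN] := eqVneq p [::].
  (* Intersections require a nonempty left part; without it v1 is a prefix of v2, an inclusion with
     the roles exchanged. *)
  subst p; have v2E : wmul [::] v2 = v2 by case: (v2).
  rewrite v2E -opprB; apply: lspanN.
  apply: (@cong_inclusion [::] s2 v2 s1 v1 m c r Ss2 sv2 Ss1 sv1 _ c0).
  by rewrite wE v2E; case: (v2).
have := @Sword_cong_ract [::] (Rmul m c) s1 v1 p (Rder 0) s2 v2 r Ss1 sv1 Ss2 sv2.
have -> : wmul [::] (rword (Rmul m c) v1) = wmul p v2.
  by rewrite -wE /=; case: (wmul (wmult v1 m) c).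
rewrite [rcomp (Rder 0) r]/= [rword (Rder 0) v2]/= wD0.
apply=> //; apply: (S_GS Ss1 Ss2).
apply: (comp_intersection sv1 sv2 (S_ind Ss1 sv1) _ erefl wE); first exact/eqP.
by rewrite wlen_wmult ltn_add2l.
Qed.

(** Both sides are compared with s1_(m) y: first [w] is replaced by [y], then s1 by its leading
    word. *)
Lemma cong_disjoint s1 v1 y w m :
  S s1 -> bar iota s1 = Some v1 -> Sw y w ->
  mspan Sw (below (wmul (wmult v1 m) w))
    (nprod m s1 (nw iota w) - pmul iota (wmult v1 m) y).
Proof.
move=> Ss1 sv1 yw; have Sr := GS_S_right; have Sl := GS_S_left.
have y_ok := Sword_left_ok C_free Sr Sl yw.
rewrite -(subrKA (nprod m s1 y)) -[X in _ + X](subrKA (nprod m (nw iota v1) y)).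
apply: lspanD; last apply: lspanD.
- rewrite -linearB; apply: nprod_S_below => //.
  rewrite -opprB; apply: lspanN; exact: (Sword_lead C_free S_monic S_ind yw).
- rewrite -nprodBl; have := S_lead C_free S_monic Ss1 sv1.
  apply: (@lspan_image _ _ _ (nprod m ^~ y)); first exact: nprod_linear_l.
  move=> _ [u -> uv]; apply: (nprod_nw_below (@Sword_left _ _ _ _ _ iota S) _ yw) => //.
  exact: S_ind sv1.
apply: (nprod_nw (@Sword_left _ _ _ _ _ iota S) _ yw) => //.
exact: S_ind sv1.
Qed.

Lemma cat_cons_split (A : Type) (a l p q : seq A) (x : A) : a ++ x :: l = p ++ q ->
  (exists2 p', p = a ++ x :: p' & l = p' ++ q) \/
  (exists2 q', a = p ++ q' & q = q' ++ x :: l).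
Proof.
elim: p a => [|y p IH] [|z a] /=.
- by move=> <-; right; exists [::].
- by move=> <-; right; exists (z :: a).
- by case=> -> ->; left; exists p.
case=> -> /IH[[p' -> ->]|[q' -> ->]]; first by left; exists p'.
by right; exists q'.
Qed.

(** Here s1 starts the word and [p] is the offset of s2. Powers of D at the end are put into the
    outer right operator, so that the compositions themselves are taken at D-free words. *)
Lemma Sword_cong_base p s1 v1 r1 s2 v2 r2 :
  S s1 -> bar iota s1 = Some v1 -> S s2 -> bar iota s2 = Some v2 ->
  rword r1 v1 = wmul p (rword r2 v2) ->
  mspan Sw (below (rword r1 v1)) (ract iota r1 s1 - pmul iota p (ract iota r2 s2)).
Proof.
move=> Ss1 sv1 Ss2 sv2.
have v10 := S_ind Ss1 sv1; have v20 := S_ind Ss2 sv2.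
case: v1 v10 sv1 => q1 [b1 i1] i10; have {i10}-> : i1 = 0%N := i10; move=> sv1.
case: v2 v20 sv2 => q2 [b2 i2] i20; have {i20}-> : i2 = 0%N := i20; move=> sv2.
case: r1 r2 => [i|m [l [e i]]] [j|n [l' [e' j]]];
  rewrite /rword /wD /wmul /wmult /= ?cat_rcons => -[].
- move=> qE bE; rewrite !add0n => ij; rewrite -ij.
  apply: (@cong_right_inclusion p s1 (q1, (b1, 0%N)) s2 (q2, (b2, 0%N)) (Rder i)) => //.
  by rewrite /wmul /= qE bE.
- rewrite add0n => qE bE ij; rewrite -bE -ij.
  have := @cong_inclusion p s1 (q1, (b1, 0%N)) s2 (q2, (b2, 0%N)) n
    (l', (b1, 0%N)) (Rder i) Ss1 sv1 Ss2 sv2.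
  by apply=> //; rewrite /wmul /wmult /= cat_rcons qE.
- move=> qE eE; rewrite add0n => ij; rewrite eE ij.
  (* s2 reaches the end of the word: it starts either behind s1 or inside it. *)
  case: (cat_cons_split qE) => [[p' -> lE]|[q' q1E q2E]].
    have yw := SwordI p' (Rder j) Ss2 sv2.
    have := cong_disjoint m Ss1 sv1 yw.
    by rewrite /wmul /wmult /= !cat_rcons -lE -cats1 !pmul_cat add0n.
  have := @cong_intersection p s1 (q1, (b1, 0%N)) s2 (q2, (b2, 0%N)) m
    (l, (b2, 0%N)) (Rder j) Ss1 sv1 Ss2 sv2.
  rewrite /rword /wD /wmul /wmult /= !add0n cat_rcons qE; apply=> //.
  by rewrite /wlen /= q2E size_cat /= ltnS leq_addl.
move=> qE eE ij; rewrite eE ij.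
case: (cat_cons_split qE) => [[p' -> lE]|[q' q1E q2E]].
  have yw := SwordI p' (Rmul n (l', (e', j))) Ss2 sv2.
  have := cong_disjoint m Ss1 sv1 yw.
  by rewrite /wmul /wmult /= !cat_rcons -lE -cats1 !pmul_cat.
(* s2 starts inside s1 and ends before s1, together with s1, or behind s1: inclusion, right
   inclusion, intersection. *)
case: (cat_cons_split q2E) => [[p' q'E l'E]|[[|bm q''] q2E' lE]].
- have := @cong_inclusion p s1 (q1, (b1, 0%N)) s2 (q2, (b2, 0%N)) n
    (p', (b1, 0%N)) (Rmul m (l, (e', j))) Ss1 sv1 Ss2 sv2.
  rewrite /rword /wmul /wmult /= !cat_rcons -l'E; apply=> //.
  by rewrite q1E q'E.
- case: lE => bE mE lE; rewrite cats0 in q2E'.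
  have := @cong_right_inclusion p s1 (q1, (b1, 0%N)) s2 (q2, (b2, 0%N))
    (Rmul m (l, (e', j))) Ss1 sv1 Ss2 sv2.
  rewrite /rword /wmul /wmult /= !cat_rcons -mE -lE; apply.
  by rewrite q1E q2E' bE.
case: lE => bE lE.
have := @cong_intersection p s1 (q1, (b1, 0%N)) s2 (q2, (b2, 0%N)) m
  (q'', (b2, 0%N)) (Rmul n (l', (e', j))) Ss1 sv1 Ss2 sv2.
rewrite /rword /wmul /wmult /= !cat_rcons -lE qE -catA; apply=> //.
  by rewrite q1E q2E' bE -!catA.
by rewrite /wlen /= q2E' size_cat /= ltnS leq_addl.
Qed.

Lemma cat_split (A : Type) (p q a b : seq A) : p ++ a = q ++ b ->
  (exists2 l, p = q ++ l & b = l ++ a) \/ (exists2 l, q = p ++ l & a = l ++ b).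
Proof.
elim: p q => [|x p IH] [|y q] /=.
- by move=> ->; left; exists [::].
- by move=> ->; right; exists (y :: q).
- by move=> <-; left; exists (x :: p).
by case=> -> /IH[[l -> ->]|[l -> ->]]; [left | right]; exists l.
Qed.

(** The shorter of the two multipliers is a common left factor and is cancelled. *)
Lemma Sword_cong x y w : Sw x w -> Sw y w -> mspan Sw (below w) (x - y).
Proof.
move=> xw; case: xw => p1 r1 s1 v1 Ss1 sv1 yw.
move wE : (wmul p1 _) yw => w' yw; case: yw wE => p2 r2 s2 v2 Ss2 sv2 wE.
have e12 : (rword r1 v1).2 = (rword r2 v2).2 by case: wE.
have /cat_split[[q pE bE]|[q pE aE]] : p1 ++ (rword r1 v1).1 = p2 ++ (rword r2 v2).1.
- by case: wE.
- have rE : rword r2 v2 = wmul q (rword r1 v1).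
    by rewrite /wmul -bE e12 -surjective_pairing.
  rewrite pE pmul_cat -opprB -linearB; apply: lspanN.
  apply: (mspan_pmul (@Sword_left _ _ _ _ _ iota S)).
  exact: Sword_cong_base rE.
have rE : rword r1 v1 = wmul q (rword r2 v2).
  by rewrite /wmul -aE -e12 -surjective_pairing.
rewrite pE pmul_cat -linearB -pE -wE.
apply: (mspan_pmul (@Sword_left _ _ _ _ _ iota S)).
exact: Sword_cong_base rE.
Qed.

Lemma bar_lead_add a x y w : a != 0 -> lead iota x w -> mspan NW (below w) y ->
  bar iota (a *: x + y) = Some w.
Proof.
move=> a0 xw yw; have /(lead_bar C_free)/bar_leading[z_w z_max] :
    lead iota (x + a^-1 *: y) w.
  by rewrite /lead addrAC; apply: lspanD => //; apply: lspanZ.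
have -> : a *: x + y = a *: (x + a^-1 *: y).
  by rewrite scalerDr scalerA divff // scale1r.
have coefsE u : coefs iota (a *: (x + a^-1 *: y)) u =
    a * coefs (N := N) iota (x + a^-1 *: y) u.
  by rewrite -[a *: _]addr0 coefs_linear // coefs0 // addr0.
apply/bar_leading; rewrite /leading /occurs coefsE mulf_neq0 //; split=> // u.
by rewrite coefsE mulf_eq0 negb_or a0 /=; apply: z_max.
Qed.

Lemma mspan_below_max (X : C -> T -> Prop) w x : mspan X (below w) x ->
  x = 0 \/ exists2 u, wlt u w & mspan X (upto u) x.
Proof.
elim=> [|a x' y [v Xv vw] _ [->|[u uw yu]]]; first by left.
- rewrite addr0; right; exists v => //; apply: lspanZ.
  by apply: (mspan_gen Xv); apply: wle_refl.
right; have [uv|vu] := orP (wle_total u v).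
  exists v => //; apply: lspanD; last first.
    by apply: mspan_sub yu => t tu; apply: wle_trans uv.
  by apply: lspanZ; apply: (mspan_gen Xv); apply: wle_refl.
by exists u => //; apply: lspanD => //; apply: lspanZ; apply: (mspan_gen Xv).
Qed.

(** Congruent S-words merge: all those with word [w] become multiples of a single one. *)
Lemma mspan_Sword_top w x : mspan Sw (upto w) x ->
  exists a y z, [/\ x = a *: y + z, mspan Sw (below w) z & a = 0 \/ Sw y w].
Proof.
elim=> [|a y x' [v yv]].
  by exists 0, 0, 0; rewrite scaler0 addr0; split=> //; [apply: lspan0 | left].
rewrite /upto wle_eqVlt => /predU1P[vw|vw] _ [b [y' [z [-> zw yw]]]].
  subst v; case: yw => [->|y'w].
    by exists a, y, z; rewrite scale0r add0r; split=> //; right.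
  exists (a + b), y, (z + b *: (y' - y)); split; last by right.
    rewrite scalerDl scalerBr -!addrA; congr (_ + _).
    by rewrite [RHS]addrCA [b *: y + _]addrC subrK addrC.
  by apply: lspanD => //; apply/lspanZ/Sword_cong.
exists b, y', (a *: y + z); rewrite addrCA; split=> //.
by apply: lspanD => //; apply/lspanZ; apply: (mspan_gen yv).
Qed.

Hypothesis B_wo : well_founded (fun a b : B => (a < b)%O).

Lemma mspan_upto (X : C -> T -> Prop) L x : mspan X (len_le L) x ->
  x = 0 \/ exists w, mspan X (upto w) x.
Proof.
elim=> [|a x' y [v Xv _] _ [->|[w yw]]]; first by left.
  by right; exists v; rewrite addr0; apply/lspanZ/(mspan_gen Xv); apply: wle_refl.
right; have [vw|wv] := orP (wle_total v w).
  by exists w; apply: lspanD => //; apply/lspanZ/(mspan_gen Xv).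
exists v; apply: lspanD.
  by apply/lspanZ/(mspan_gen Xv); apply: wle_refl.
by apply: mspan_sub yw => t tw; apply: wle_trans wv.
Qed.

(** Descent on an upper bound [w] of the S-words. After merging, a nonzero coefficient at [w] cannot
    be cancelled from below; a zero one lowers the bound. *)
Lemma composition_diamond L x : mspan Sw (len_le L) x ->
  x = 0 \/ exists y w, Sw y w /\ bar iota x = Some w.
Proof.
move=> /mspan_upto[|[w]]; first by left.
elim/(well_founded_ind (wlt_wf (N := N) B_wo)): w => w IH xw.
have [a [y [z [xE zw yw]]]] := mspan_Sword_top xw.
have [a0|a0] := eqVneq a 0.
  move: xE; rewrite a0 scale0r add0r => xE; rewrite -xE in zw.
  by have [->|[u uw /(IH u uw)]] := mspan_below_max zw; first by left.
case: yw => [a0'|yw]; first by rewrite a0' eqxx in a0.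
right; exists y, w; split=> //; rewrite xE; apply: bar_lead_add => //.
  exact: (Sword_lead C_free S_monic S_ind yw).
apply: lspan_trans zw => t [u tu uw].
rewrite -[t](subrK (nw iota u)); apply: lspanD.
  have := Sword_lead C_free S_monic S_ind tu.
  by apply: mspan_sub => v vu; exact: (wlt_trans vu uw).
by apply: (@mspan_gen _ _ _ _ _ NW _ _ u).
Qed.

Lemma Id_Sword x : ideal_set (Id S) x -> exists L, mspan Sw (len_le L) x.
Proof.
have Sr := GS_S_right; have Sl := GS_S_left.
pose I : set C := [set y | exists L, mspan Sw (len_le L) y]%classic.
have I_ideal : is_conf_ideal I.
  split.
  - by exists 0%N; apply: lspan0.
  - move=> a y z [L yL] [L' zL]; exists (maxn L L'); apply: lspanD.
      by apply: lspanZ; apply: mspan_len yL; apply: leq_maxl.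
    by apply: mspan_len zL; apply: leq_maxr.
  - move=> y [L yL]; exists L; exact: (mspan_Sword_cder_len yL).
  - move=> n y z [L zL]; have [L' yL] := nw_span C_free y; exists (L' + L)%N.
    have z_ok := mspan_Sword_left_ok C_free Sr Sl zL.
    apply: (@lspan_image _ _ _ (nprod n ^~ z)) yL; first exact: nprod_linear_l.
    move=> _ [u -> uL].
    apply: (@mspan_len _ _ _ _ _ _ (wlen u + L)); first by rewrite leq_add2r.
    exact: (nw_right_ok (@Sword_left _ _ _ _ _ iota S) u z_ok n).
  move=> n y z [L yL]; have [L' zL] := nw_span C_free z; exists (L + L')%N.
  exact: (Sword_right_len C_free Sr).
have SI : (S `<=` I)%classic.
  move=> s Ss; have [v sv] := S_bar S_monic Ss.
  exists (wlen v); exact: (ract_len (Rder 0) Ss sv).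
by move=> xId; exact: (xId I (conj I_ideal SI)).
Qed.

End Basis.
End Confluence.

(** * Irreducible words and the quotient *)

Section Hom.
Context {k : fieldType} {C C' : confAlgType k} (phi : C -> C').
Hypothesis phi_hom : conf_hom phi.

Lemma conf_hom_lincomb (c : {fsfun C -> {poly k} with 0}) :
  phi (lincomb (M := kD_module C) id c) = lincomb (M := kD_module C') phi c.
Proof.
have [phi_l phi_D _] := phi_hom.
have phi0 : phi 0 = 0.
  by have := phi_l (-1) 0 0; rewrite scaler0 addr0 scaleN1r addNr.
have phi_iter i x : phi (iter i cder x) = iter i cder (phi x).
  by elim: i => //= i IH; rewrite phi_D IH.
have phi_kD p x : phi (kD_scale p x) = kD_scale p (phi x).
  rewrite /kD_scale; elim/big_rec2: _ => // i y z _ <-.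
  by rewrite phi_l phi_iter.
rewrite /lincomb; elim/big_rec2: _ => // j y z _ <-.
rewrite -[X in phi X]/((kD_scale (c j) j : C) + z).
by have := phi_l 1 (kD_scale (c j) j) z; rewrite !scale1r phi_kD => ->.
Qed.

End Hom.

Section Irreducible.
Context {k : fieldType} {disp : Order.disp_t} {B : orderType disp} {N : nat}.
Context {C : assocConfAlgType k} (iota : B -> C).
Hypothesis C_free : free_assoc_conf N iota.
Hypothesis B_wo : well_founded (fun a b : B => (a < b)%O).
Local Notation T := (word B N).
Local Notation NW := (normal_word (N := N) iota).
Implicit Types (u v w c : T) (p q : multiplier B N) (x y z s h : C) (b : B)
  (P Q : pred T) (r t : rop (B := B) (N := N)).

Variable S : set C.
Hypothesis S_monic : forall s, S s -> nw_monic N iota s.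
Hypothesis S_ind : forall s w, S s -> bar iota s = Some w -> ind w = 0%N.
Local Notation Sw := (Sword (N := N) iota S).

Definition reducible w : Prop := exists x, Sw x w.

Lemma reducibleP w : reducible w <->
  exists2 x, normal_Sword (N := N) iota S x & bar iota x = Some w.
Proof.
split=> [[x xw]|[x /(normal_Sword_mark S_monic)[v xv]]].
  exists x; first exact: (Sword_normal S_ind xw).
  exact: (Sword_bar C_free S_monic S_ind xw).
by rewrite (Sword_bar C_free S_monic S_ind xv) => -[<-]; exists x.
Qed.

(** Leading words of S are D-free, so the powers of D in a reducible word belong to the right
    operator and can be removed or added there. *)
Lemma reducible_wD u i : ind u = 0%N -> reducible (wD u i) <-> reducible u.
Proof.
case: u => p [b j] j0; have {j0}-> : j = 0%N := j0; split=> -[x].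
  move wE : (wD _ _) => w xw; case: xw wE => q r s v Ss sv.
  have v0 := S_ind Ss sv; case: v v0 sv => l [d e] e0; have {e0}-> : e = 0%N := e0.
  move=> sv; rewrite /wD add0n /=; case: r => [e'|m [l' [d' e']]].
    rewrite /rword /wD /wmul /= => -[-> -> _].
    by eexists; apply: (SwordI q (Rder 0) Ss sv).
  rewrite /rword /wmul /= => -[-> -> _].
  by eexists; apply: (SwordI q (Rmul m (l', (d', 0%N))) Ss sv).
move wE : (p, _) => w xw; case: xw wE => q r s v Ss sv _.
case: r => [e|m c].
  by eexists; rewrite wmul_wD /= wDD; apply: (SwordI q (Rder (e + i)) Ss sv).
by eexists; apply: (SwordI q (Rmul m (wD c i)) Ss sv).
Qed.

Lemma D_free_IrrP x : D_free_Irr N iota S x <->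
  exists u, [/\ x = nw iota u, ind u = 0%N & ~ reducible u].
Proof.
split=> [[u [[v v_irr vu] u0] ux]|[u [-> u0 u_irr]]].
  exists u; split=> //; rewrite -(nw_inj C_free vu) => /reducibleP[y ySw yv].
  exact: v_irr ySw yv.
exists u => //; split=> //; exists u => // y ySw yu.
by apply/u_irr/reducibleP; exists y.
Qed.

(** The elements D^i [u], rather than the normal words [u D^i] which they have as leading terms,
    span over [k] the k[D]-module generated by A. *)
Definition D_irr (x : C) (w : T) : Prop := exists u i,
  [/\ ind u = 0%N, ~ reducible u, x = iter i cder (nw iota u) & w = wD u i].

(** Every word is the leading word of an S-word or of some D^i [u] with [u] irreducible; subtracting
    that element leaves smaller words. *)
Lemma mspan_divide P x : down_closed P -> mspan NW P x ->
  exists y z, [/\ x = y + z, mspan Sw P y & mspan D_irr P z].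
Proof.
move=> P_down.
have divS y z y' z' a : mspan Sw P y -> mspan D_irr P z -> mspan Sw P y' ->
    mspan D_irr P z' -> exists f g, [/\ a *: (y + z) + (y' + z') = f + g,
      mspan Sw P f & mspan D_irr P g].
  move=> yP zP yP' zP'; exists (a *: y + y'), (a *: z + z').
  by rewrite scalerDr addrACA; split=> //; apply: lspanD => //; apply: lspanZ.
pose D x := exists y z, [/\ x = y + z, mspan Sw P y & mspan D_irr P z].
have D_span y (Y : pred T) : (forall w', Y w' -> P w' -> D (nw iota w')) ->
    subpred Y P -> mspan NW Y y -> D y.
  move=> nwD YP; elim=> [|a _ f [u -> Yu] _ [f1 [f2 [-> f1P f2P]]]].
    by exists 0, 0; rewrite addr0; split=> //; apply: lspan0.
  by have [g1 [g2 [-> g1P g2P]]] := nwD u Yu (YP _ Yu); apply: divS.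
suff nwD w : P w -> D (nw iota w) by move=> xP; apply: (D_span x P) => // w _; apply: nwD.
elim/(well_founded_ind (wlt_wf (N := N) B_wo)): w => w IH Pw.
have D_below y : mspan NW (below w) y -> D y.
  apply: D_span => v vw; first by move=> Pv; apply: IH.
  exact: (P_down _ _ (ltW vw) Pw).
suff [y yw yD] : exists2 y, lead iota y w & D y.
  have [f [g [yE fP gP]]] := yD; have [f' [g' [lE f'P g'P]]] := D_below _ yw.
  have -> : nw iota w = (-1) *: (f' + g') + (f + g).
    by rewrite -lE -yE scaleN1r opprB subrK.
  exact: divS.
have [[y yw]|w_irr] := pselect (reducible w).
  exists y; first exact: (Sword_lead C_free S_monic S_ind yw).
  exists y, 0; rewrite addr0; split=> //; last exact: lspan0.
  exact: (mspan_gen yw).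
case: w {IH D_below} Pw w_irr => p [b i] Pw w_irr.
pose u : T := (p, (b, 0%N)).
have wE : (p, (b, i)) = wD u i by rewrite /wD add0n.
rewrite wE in Pw w_irr *; exists (iter i cder (nw iota u)).
  exact/lead_iter_cder/lead_nw.
exists 0, (iter i cder (nw iota u)); rewrite add0r; split=> //; first exact: lspan0.
apply: mspan_gen Pw; exists u, i; split=> // u_red.
by apply/w_irr/reducible_wD.
Qed.

Lemma kD_scaleXn (a : k) i x :
  kD_scale (a *: 'X^i) (x : kD_module C) = a *: iter i cder x.
Proof.
have -> : kD_scale (a *: 'X^i) (x : kD_module C) = a *: (kD_scale 'X^i x : C).
  by have := kD_scalePl a 'X^i 0 x; rewrite kD_scale0 !addr0.
suff -> : kD_scale 'X^i (x : kD_module C) = iter i cder x by [].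
elim: i => [|i IH]; first by rewrite expr0 kD_scale1.
by rewrite exprS kD_scaleXM IH.
Qed.

Lemma D_irr_lincomb P x : mspan D_irr P x ->
  exists c : {fsfun C -> {poly k} with 0},
    (forall j, j \in finsupp c -> D_free_Irr N iota S j) /\
    x = lincomb (M := kD_module C) id c.
Proof.
move=> xP; apply/(lspan_lincombP (V := kD_module C) id (D_free_Irr N iota S)).
elim: xP => [|a _ y [w [u [i [u0 u_irr -> _]]] _] _ IH]; first exact: lspan0.
have jD : D_free_Irr N iota S (nw iota u) by apply/D_free_IrrP; exists u.
rewrite -kD_scaleXn; apply: (lspanZD (V := kD_module C) (a *: 'X^i) _ IH).
by exists (nw iota u).
Qed.

Lemma bar_addr x y u v : bar iota x = Some u -> bar iota y = Some v -> wlt u v ->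
  bar iota (x + y) = Some v.
Proof.
move=> /bar_leading[_ x_max] /bar_leading[yv y_max] uv.
have coefsE w : coefs iota (x + y) w = coefs (N := N) iota x w + coefs iota y w.
  by have := coefs_linear C_free 1 x y w; rewrite scale1r mul1r.
apply/bar_leading; split=> [|w]; rewrite /occurs coefsE.
  have [xv|/negPn/eqP->] := boolP (coefs iota x v != 0); last by rewrite add0r.
  by have := x_max v xv; rewrite wleNgt uv.
have [xw _|/negPn/eqP->] := boolP (coefs iota x w != 0).
  exact: wle_trans (x_max w xw) (ltW uv).
by rewrite add0r; apply: y_max.
Qed.

Lemma bar_sum_distinct (J : eqType) (F : seq J) (y : J -> C) : uniq F -> F != [::] ->
  (forall j, j \in F -> exists w : T, bar iota (y j) = Some w) ->
  {in F &, injective (fun j => bar (N := N) iota (y j))} ->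
  exists2 j, j \in F & bar (N := N) iota (\sum_(j <- F) y j) = bar iota (y j).
Proof.
elim: F => // j F IH /= /andP[jF F_uniq] _ y_bar y_inj.
have [->|F0] := eqVneq F [::].
  by exists j; rewrite ?inE // big_cons big_nil addr0.
have FjF i : i \in F -> i \in j :: F by rewrite inE => ->; rewrite orbT.
have [i iF iE] := IH F_uniq F0 (fun i iF => y_bar i (FjF i iF))
  (fun i i' iF i'F => y_inj i i' (FjF i iF) (FjF i' i'F)).
have jjF : j \in j :: F by rewrite inE eqxx.
have [u uE] := y_bar j jjF; have [v vE] := y_bar i (FjF i iF).
rewrite vE in iE; rewrite big_cons.
have [] := orP (wle_total u v); rewrite wle_eqVlt.
  case/predU1P => [uv'|lt_uv].
    have ji : j = i by apply: y_inj => //=; [apply: FjF | rewrite uE vE uv'].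
    by rewrite ji iF in jF.
  by exists i; [apply: FjF | rewrite vE; apply: bar_addr lt_uv].
case/predU1P => [uv'|lt_vu].
  have ji : j = i by apply: y_inj => //=; [apply: FjF | rewrite uE vE uv'].
  by rewrite ji iF in jF.
by exists j; rewrite // uE addrC; apply: bar_addr lt_vu.
Qed.

(** The word u D^i increases with i, so the top coefficient of [p] decides. *)
Lemma bar_kD_scale (p : {poly k}) u : p != 0 ->
  bar iota (kD_scale p (nw iota u : kD_module C) : C) = Some (wD u (size p).-1).
Proof.
move=> p0; rewrite /kD_scale; have : (0 < size p)%N by rewrite size_poly_gt0.
have := lead_coef_eq0 p; rewrite /lead_coef (negPf p0) => /negbT.
case: (size p) => // n /= pn _; rewrite big_ord_recr /= addrC.
apply: (bar_lead_add C_free) => //; first exact/lead_iter_cder/lead_nw.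
apply: lspan_sum => i _; apply: lspanZ.
rewrite -[iter _ _ _](subrK (nw iota (wD u i))).
have lt_i : wlt (wD u i) (wD u n).
  case: (u) => q [b j]; elim: q => [|bn q IH].
    by rewrite wlt_nil eqxx ltn_add2l ltn_ord /= orbT.
  rewrite -[wD _ i]/(wcons bn (wD (q, (b, j)) i)).
  by rewrite -[wD _ n]/(wcons bn (wD (q, (b, j)) n)) wlt_wcons.
apply: lspanD; last by apply: (@mspan_gen _ _ _ _ _ NW _ _ (wD u i)).
have := lead_iter_cder i (lead_nw iota u).
by apply: mspan_sub => v vi; exact: (wlt_trans vi lt_i).
Qed.

Lemma Sword_Id x w : Sw x w -> ideal_set (Id S) x.
Proof.
case=> p r s v Ss _; have [_ _ I_cder I_r I_l] := ideal_setP (Id S).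
elim: p => [|bn p IH] /=; last exact: I_r.
have Is : ideal_set (Id S) s by move=> I [_]; apply.
case: r => [i|m c] /=; last exact: I_l.
by elim: i => //= i IH; apply: I_cder.
Qed.

Lemma mspan_Sword_Id P x : mspan Sw P x -> ideal_set (Id S) x.
Proof.
have [I0 I_lin _ _ _] := ideal_setP (Id S).
by elim=> [|a y z [w yw _] _ IH] //; apply: I_lin => //; apply: Sword_Id yw.
Qed.

Lemma composition_Id f g h : S f -> S g -> composition (N := N) iota f g h ->
  ideal_set (Id S) h.
Proof.
move=> Sf Sg; have [I0 I_lin I_cder I_r I_l] := ideal_setP (Id S).
have If : ideal_set (Id S) f by move=> I [_]; apply.
have Ig : ideal_set (Id S) g by move=> I [_]; apply.
have I_sub x y : ideal_set (Id S) x -> ideal_set (Id S) y -> ideal_set (Id S) (x - y).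
  by move=> Ix Iy; rewrite addrC -scaleN1r; apply: I_lin.
have I_pmul p x : ideal_set (Id S) x -> ideal_set (Id S) (pmul iota p x).
  by move=> Ix; elim: p => //= bn p IH; apply: I_r.
have I_iter i x : ideal_set (Id S) x -> ideal_set (Id S) (iter i cder x).
  by move=> Ix; elim: i => //= i IH; apply: I_cder.
by case=> *; auto.
Qed.

End Irreducible.

Unset Implicit Arguments.
Set Strict Implicit.

Theorem proposition4p1 (k : fieldType) (k_char0 : [pchar k] =i pred0)
  (disp : Order.disp_t) (B : orderType disp)
  (B_wo : well_founded (fun a b : B => (a < b)%O))
  (N : nat) (C : assocConfAlgType k) (iota : B -> C)
  (C_free : free_assoc_conf N iota)
  (S : set C)
  (S_monic : forall s, S s -> nw_monic N iota s)
  (S_ind : forall s (w : word B N), S s -> bar iota s = Some w -> ind w = 0%N) :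
  GS_basis N iota S <->
  is_basis (M := kD_module (conf_quot (Id S)))
    (D_free_Irr N iota S) (qproj (Id S)).
Proof.
have pi_hom := @qproj_hom k C (Id S).
have pi0 x : ideal_set (Id S) x <-> qproj (Id S) x = 0.
  by rewrite -(linear0 (qproj (Id S))) qproj_eq subr0.
have IrrE := D_free_IrrP C_free S_monic S_ind.
have divide (P : pred (word B N)) x : down_closed P ->
    mspan (normal_word iota) P x ->
    exists (y : C) (c : {fsfun C -> {poly k} with 0}),
    [/\ x = y + lincomb (M := kD_module C) id c, mspan (Sword iota S) P y &
      forall j, j \in finsupp c -> D_free_Irr N iota S j].
  move=> P_down /(mspan_divide C_free B_wo S_monic S_ind P_down)[y [z [-> yP]]].
  by move/(D_irr_lincomb C_free S_monic S_ind) => [c [cA ->]]; exists y, c.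
split=> [S_GS|[_ A_indep] f g h Sf Sg fgh]; first split=> [x|c cA c0 j].
(* Generation: a representative is divided by S-words, and the quotient part vanishes modulo
   Id(S). *)
- have [L yL] := nw_span C_free (qrepr x).
  have [y [c [xE /mspan_Sword_Id y_Id cA]]] := divide _ _ (@len_le_down _ _ _ L) yL.
  exists c; split=> //; rewrite -(conf_hom_lincomb pi_hom) -[LHS]qreprK xE linearD /=.
  by rewrite (pi0 y).1 ?add0r.
(* Independence: a nontrivial relation would give a nonzero element of Id(S) with leading word u
   D^i, [u] irreducible and D-free, against the composition-diamond lemma. *)
- apply/eqP/negPn/negP => cj0.
  pose y j : C := kD_scale (c j) (j : kD_module C).
  have y_bar i : i \in finsupp c -> exists u, [/\ i = nw iota u, ind u = 0%N,
      ~ reducible (N := N) iota S u & bar iota (y i) = Some (wD u (size (c i)).-1)].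
    move=> ic; have [u [iE u0 u_irr]] := (IrrE i).1 (cA i ic); subst i.
    exists u; split=> //; apply: (bar_kD_scale C_free).
    by rewrite -mem_finsupp.
  have c_nil : (finsupp c : seq C) != [::].
    apply/eqP => E0; case/negP: cj0.
    apply/eqP/fsfun_dflt/negP => jc.
    by have : j \in (finsupp c : seq C) by []; rewrite E0.
  (* Since [u] is D-free, it can be read off from u D^i. *)
  have y_inj : {in (finsupp c : seq C) &, injective (fun i => bar (N := N) iota (y i))}.
    move=> i i' /y_bar[u [-> u0 _ uE]] /y_bar[u' [-> u'0 _ u'E]] /=.
    rewrite uE u'E => -[E1 E2 _].
    case: u u0 {uE} E1 E2 => p [b d] /= d0.
    case: u' u'0 {u'E} => p' [b' d'] /= d'0 -> ->.
    by rewrite [d]d0 [d']d'0.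
  have [i|i ic f_bar] := bar_sum_distinct C_free (fset_uniq (finsupp c)) c_nil _ y_inj.
    by move=> /y_bar[u [_ _ _ uE]]; exists (wD u (size (c i)).-1).
  have [u [_ u0 u_irr uE]] := y_bar i ic.
  have f_Id : ideal_set (Id S) (lincomb (M := kD_module C) id c).
    by apply/pi0; rewrite (conf_hom_lincomb pi_hom).
  have [L fL] := Id_Sword C_free S_monic S_ind S_GS f_Id.
  rewrite uE in f_bar.
  have [f0|[z [w [zw]]]] := composition_diamond C_free S_monic S_ind S_GS B_wo fL.
    have /bar_leading[f_occ _] := f_bar.
    by move: f_occ; rewrite /occurs [X in coefs _ X](f0 : _ = 0 :> C) coefs0 // eqxx.
  rewrite [bar iota _]f_bar => -[wE]; apply: u_irr.
  by apply/(reducible_wD S_ind (size (c i)).-1 u0); exists z; rewrite wE.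
(* Converse: dividing [h] within the words up to [bar h] leaves a combination of A lying in Id(S);
   independence kills it, and what remains witnesses triviality. *)
have hI := composition_Id Sf Sg fgh.
apply/(lspan_lincombP id (fun x => normal_Sword (N := N) iota S x /\
  owle (bar iota x) (bar (N := N) iota h))).
case h_bar : (bar iota h) => [w|]; last first.
  by rewrite (bar_None C_free h_bar); apply: lspan0.
have [y [c [hE yw cA]]] := divide _ _ (@upto_down _ _ _ w) (bar_mspan C_free h_bar).
have c0 : forall j, c j = 0.
  apply: A_indep cA _; rewrite -(conf_hom_lincomb pi_hom).
  have := (pi0 h).1 hI; rewrite hE linearD /= (pi0 y).1 ?add0r //.
  exact: mspan_Sword_Id yw.
have -> : h = y.
  by rewrite hE /lincomb big1 ?addr0 // => j _; rewrite c0 scale0r.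
apply: lspan_mono yw => x [v xv vw]; exists x; last by [].
split; first exact: (Sword_normal S_ind xv).
by rewrite (Sword_bar C_free S_monic S_ind xv).
Qed.
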